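(* Let $(\Gamma,\mu)$ be a weighted graph satisfying: $(p_0)$: there is $p_0>0$ with $\mu_{x,y}/\mu(x)\ge p_0$ for all adjacent $x\sim y$; $(VD)$: there is $D_V>0$ with $V(x,2R)\le D_V V(x,R)$ for all $x\in\Gamma$, $R>0$; $(H)$: there is $H>1$ such that for all $x\in\Gamma$, $R>0$ and every non-negative function $u$ harmonic in $B(x,2R)$, $\max_{B(x,R)}u\le H\min_{B(x,R)}u$; and the anti-doubling property of $\rho v$: there is $A>1$ such that for all $x\in\Gamma$, $R>0$ $$\rho(x,AR,2AR)\,v(x,AR,2AR)\ge 2\,\rho(x,R,2R)\,v(x,R,2R).$$ Then there is a constant $C>1$ such that for all $x\in\Gamma$ and all real $R\ge1$ $$C^{-1}\rho(x,R,2R)\,v(x,R,2R)\le E(x,2R)\le C\,\rho(x,R,2R)\,v(x,R,2R).$$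
   Context: $\Gamma$ is a countably infinite connected graph ($x\sim y$ denotes adjacency) with weights $\mu_{x,y}=\mu_{y,x}>0$ on its edges ($\mu_{x,y}=0$ if $x\not\sim y$); $\mu(x)=\sum_{y\sim x}\mu_{x,y}$ and $\mu(A)=\sum_{y\in A}\mu(y)$. $X_n$ is the random walk with transition probabilities $P(x,y)=\mu_{x,y}/\mu(x)$; $Pf(x)=\sum_yP(x,y)f(y)$, $\Delta=P-I$, $(f,g)_\mu=\sum_x f(x)g(x)\mu(x)$. $d$ is the shortest-path distance, $B(x,R)=\{y: d(x,y)<R\}$, $V(x,R)=\mu(B(x,R))$, $v(x,r,R)=V(x,R)-V(x,r)$. $T_A=\min\{k\ge 0: X_k\notin A\}$ and $E(x,R)=\mathbb{E}(T_{B(x,R)}\mid X_0=x)$. For $A\subset\Gamma$, $\overline{A}$ is $A$ together with all vertices adjacent to a vertex of $A$; a function $h$ is harmonic on $A$ if it is defined on $\overline{A}$ and $Ph(x)=h(x)$ for all $x\in A$ (non-negativity is required on $\overline A$). The resistance between disjoint sets $A,B$ is $\rho(A,B)=\left(\inf\{(-\Delta f,f)_\mu: f|_A=1,\ f|_B=0\}\right)^{-1}$, where $(-\Delta f,f)_\mu=\frac12\sum_{x,y}\mu_{x,y}(f(x)-f(y))^2$; and $\rho(x,r,R)=\rho(B(x,r),\Gamma\setminus B(x,R))$. *)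

(* Defs.v *)
From HB Require Import structures.
From mathcomp Require Import all_boot all_order all_algebra.
From mathcomp Require Import all_classical all_reals all_analysis.

Set Implicit Arguments.
Unset Strict Implicit.
Unset Printing Implicit Defensive.

Import Order.TTheory GRing.Theory Num.Theory.

Local Open Scope classical_set_scope.
Local Open Scope ring_scope.

(* A weighted graph, presented by its weights: x ~ y means 0 < weight x y.
   Loops are allowed; local finiteness is not assumed. *)
Record wgraph (R : realType) := WGraph {
  vertex :> countType;
  weight : vertex -> vertex -> R;
  weight_sym : forall x y, weight x y = weight y x;
  weight_ge0 : forall x y, 0 <= weight x y;
  vertex_infinite : infinite_set [set: vertex];
  vertex_connected : forall x y : vertex, exists p : seq vertex,
    path (fun a b => 0 < weight a b) x p /\ last x p = y
}.

Section WeightedGraph.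
Context {R : realType} (G : wgraph R).

Definition adj : rel G := fun x y => 0 < weight x y.

Definition is_walk (x y : G) (n : nat) : Prop :=
  exists p : seq G, [/\ path adj x p, last x p = y & size p = n].

Lemma walk_exists (x y : G) : exists n, `[< is_walk x y n >].
Proof.
have [p [xp py]] := vertex_connected x y.
by exists (size p); apply/asboolP; exists p.
Qed.

Definition gdist (x y : G) : nat := ex_minn (walk_exists x y).

Definition gball (x : G) (r : R) : set G := [set y | (gdist x y)%:R < r].

Definition mu (x : G) : \bar R :=
  (\esum_(y in [set y | adj x y]) (weight x y)%:E)%E.

Definition muset (A : set G) : \bar R := (\esum_(y in A) mu y)%E.

Definition vol (x : G) (r : R) : \bar R := muset (gball x r).

Definition annulus_vol (x : G) (r s : R) : \bar R := (vol x s - vol x r)%E.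

Definition trans (x y : G) : R := weight x y / fine (mu x).

(* \sum_( _ \in _) is a sum over a finite support (0 if the support is
   infinite).  This is harmless under condition p0 below, which bounds the
   number of neighbours of every vertex by 1 / p0; an infinite mu x is
   excluded as well, since then fine (mu x) = 0 and trans x y = 0. *)
Definition markov_op (f : G -> R) (x : G) : R :=
  \sum_(y \in [set: G]) trans x y * f y.

Definition gclosure (A : set G) : set G :=
  A `|` [set y | exists2 x, A x & adj x y].

(* Functions on gclosure A are represented by total functions, whose values
   outside gclosure A play no role. *)
Definition harmonic_on (A : set G) (h : G -> R) : Prop :=
  forall x, A x -> markov_op h x = h x.

Definition dirichlet (f : G -> R) : \bar R :=
  ((2^-1)%:E * \esum_(p in [set: G * G])
     (weight p.1 p.2 * (f p.1 - f p.2) ^+ 2)%:E)%E.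

Definition resistance (A B : set G) : \bar R :=
  (ereal_inf [set dirichlet f | f in
     [set f : G -> R | (forall x, A x -> f x = 1%R) /\
                       (forall x, B x -> f x = 0%R)]])^-1%E.

Definition annulus_res (x : G) (r s : R) : \bar R :=
  resistance (gball x r) (~` gball x s).

(* Pr x is the law of the walk conditioned on X_0 = x.  The Markov property is
   in product form, which avoids conditioning on null events. *)
Record random_walk (d : measure_display) (Omega : measurableType d)
    (Pr : G -> probability Omega R) (X : nat -> Omega -> G) : Prop := {
  rw_measurable : forall n y, measurable (X n @^-1` [set y]);
  rw_start : forall x, Pr x (X 0%N @^-1` [set x]) = 1%E;
  rw_markov : forall (x : G) (n : nat) (p : nat -> G),
    Pr x [set w | forall i, (i <= n.+1)%N -> X i w = p i] =
    (Pr x [set w | forall i, (i <= n)%N -> X i w = p i] *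
       (trans (p n) (p n.+1))%:E)%E
}.

Definition exit_time (Omega : Type) (X : nat -> Omega -> G) (A : set G)
    (w : Omega) : \bar R :=
  ereal_inf [set (k%:R)%:E | k in [set k | ~ A (X k w)]].

Definition mean_exit_time (d : measure_display) (Omega : measurableType d)
    (Pr : G -> probability Omega R) (X : nat -> Omega -> G)
    (x : G) (r : R) : \bar R :=
  (\int[Pr x]_w exit_time X (gball x r) w)%E.

Definition cond_p0 : Prop :=
  exists2 p0 : R, 0 < p0 &
    forall x y : G, adj x y -> p0 <= trans x y.

Definition volume_doubling : Prop :=
  exists2 D : R, 0 < D &
    forall (x : G) (r : R), 0 < r -> (vol x (2 * r) <= D%:E * vol x r)%E.

Definition elliptic_harnack : Prop :=
  exists2 H : R, 1 < H &
    forall (x : G) (r : R) (u : G -> R), 0 < r ->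
      harmonic_on (gball x (2 * r)) u ->
      (forall y, gclosure (gball x (2 * r)) y -> 0 <= u y) ->
      forall y z, gball x r y -> gball x r z -> u y <= H * u z.

Definition res_vol (x : G) (r : R) : \bar R :=
  (annulus_res x r (2 * r) * annulus_vol x r (2 * r))%E.

Definition anti_doubling : Prop :=
  exists2 A : R, 1 < A &
    forall (x : G) (r : R), 0 < r ->
      (2%:E * res_vol x r <= res_vol x (A * r))%E.

End WeightedGraph.

(* Main.v *)
From HB Require Import structures.
Require Import Defs.
From mathcomp Require Import all_boot all_order all_algebra finmap.
From mathcomp Require Import all_classical all_reals all_analysis measurable_realfun.
From mathcomp Require Import zify ring lra.
Set Implicit Arguments.
Unset Strict Implicit.
Unset Printing Implicit Defensive.
Import Order.TTheory GRing.Theory Num.Theory.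
Import numFieldNormedType.Exports.
Local Open Scope classical_set_scope.
Local Open Scope ring_scope.

(* Let g be the Green function at x of the walk killed outside U = B(x,2R), so
   that E(x,2R) is the sum of g mu over U.  Applying (H) along geodesics, and the
   symmetry of g to go around the pole x, all values of g on the spheres of radii
   between R/A and R are comparable; by the maximum principle this gives an a > 0
   with g >= a on B(x,R) and g <= K a outside B(x,R/A).  Truncating g at heights a
   and K a / p0 yields a <= rho(x,R,2R) <= K a / p0.
   Lower bound: E(x,2R) >= a V(x,R), and V(x,R) dominates v(x,R,2R) by (VD).
   Upper bound: the Green functions of B(x,2R) and B(x,2R/A) differ by at most K a,
   and V(x,2R) is dominated by v(x,R,2R), so with w(R) = rho v one has
   E(x,2R) <= E(x,2R/A) + C w(R); as w(R/A) <= w(R)/2, induction gives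
   E(x,2R) <= 2 C w(R). *)

(* [lia] does not terminate in the presence of order hypotheses over R. *)
Ltac nat_lia := repeat match goal with
  | h : is_true (Order.le _ _) |- _ => clear h
  | h : is_true (Order.lt _ _) |- _ => clear h
  end; lia.

(** Condition (p_0) bounds the degrees, so balls are finite and the killed Green function solves a
    finite linear system; the maximum principle gives uniqueness, hence existence. Probability
    enters only to identify E(x,2R) with the sum of g mu, through the series of survival
    probabilities. The obstacle is the pole: the natural path between two points y, z of a sphere
    passes through x, where g is not harmonic, and no hypothesis supplies a path around x. When y
    and z are far apart, the pole is therefore moved to y, the Harnack chain runs along the geodesic
    from x to z, and symmetry converts the result back. Harnack balls have radius of order s = R /
    (32 A). For small R they may reduce to a vertex, where (H) is void; comparison along single
    edges, at a cost of p_0^-1 each, replaces it. The same comparison produces the 1/p_0 in the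
    resistance bound: a competitor is known to be constant only on B(x,R), so the neighbours of {g >
    K a / p_0} must lie in that ball too. The induction on scales bottoms out at R < A, where every
    vertex but x lies outside B(x,R/A). *)

Lemma nat_ceil (R : realType) (t : R) : 0 <= t ->
  exists n : nat, t <= n%:R < t + 1.
Proof.
move=> t0; have ex : exists n, t <= n%:R :> R.
  by exists (Num.truncn t).+1; apply/ltW/truncnS_gt.
have [[|n] tn nmin] := ex_minnP ex; first by exists 0%N; rewrite tn ltr_wpDl.
exists n.+1; rewrite tn /= -natr1 ltrD2r ltNge.
by apply/negP => /nmin; rewrite ltnn.
Qed.
Lemma min_monotone (R : realDomainType) (u v b : R) :
  0 <= (u - v) * (Num.min u b - Num.min v b).
Proof.
rewrite /Order.min; case: ltP => ub; case: ltP => vb.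
- by rewrite -expr2 sqr_ge0.
- by rewrite -mulrNN mulr_ge0 //; lra.
- by rewrite mulr_ge0 //; lra.
- by rewrite subrr mulr0.
Qed.

(** Truncation is monotone and 1-Lipschitz: along an edge, the squared increment of the truncated
    function is at most the product of the two increments. *)
Lemma min_contracts (R : realDomainType) (u v b : R) :
  0 <= ((u - v) - (Num.min u b - Num.min v b)) * (Num.min u b - Num.min v b).
Proof.
rewrite /Order.min; case: ltP => ub; case: ltP => vb.
- by rewrite subrr mul0r.
- by rewrite -mulrNN mulr_ge0 //; lra.
- by rewrite mulr_ge0 //; lra.
- by rewrite subrr mulr0.
Qed.

Lemma expr_unbounded (R : realType) (A t : R) : 1 < A -> exists n, t < A ^+ n.
Proof.
move=> A1; have bern n : 1 + n%:R * (A - 1) <= A ^+ n.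
  elim: n => [|n IH]; first by rewrite mul0r addr0.
  have sq : 0 <= n%:R * (A - 1) ^+ 2 by rewrite mulr_ge0 ?sqr_ge0.
  have : A * (1 + n%:R * (A - 1)) <= A * A ^+ n by rewrite ler_wpM2l //; lra.
  rewrite exprS -natr1; lra.
exists (Num.truncn (t / (A - 1))).+1; apply: lt_le_trans (bern _).
have := truncnS_gt (t / (A - 1)); rewrite ltr_pdivrMr; lra.
Qed.

(** * Graph distance *)

Section GraphDistance.
Context {R : realType} (G : wgraph R).
Implicit Types (x y z : G) (m n : nat).

Lemma adj_sym x y : adj x y = adj y x.
Proof. by rewrite /adj weight_sym. Qed.

Lemma weight_nadj x y : ~~ adj x y -> weight x y = 0.
Proof. by move=> n; apply/le_anti; rewrite weight_ge0 andbT leNgt. Qed.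

Lemma gdist_walk x y : is_walk x y (gdist x y).
Proof. by rewrite /gdist; case: ex_minnP => m /asboolP. Qed.

Lemma gdist_le x y n : is_walk x y n -> (gdist x y <= n)%N.
Proof. by move=> w; rewrite /gdist; case: ex_minnP => m _; apply; apply/asboolP. Qed.

Lemma walk_cat x y z m n : is_walk x y m -> is_walk y z n -> is_walk x z (m + n).
Proof.
move=> [p [xp py pm]] [q [yq qz qn]]; exists (p ++ q); split.
- by rewrite cat_path xp py.
- by rewrite last_cat py.
- by rewrite size_cat pm qn.
Qed.

Lemma walk_rev x y n : is_walk x y n -> is_walk y x n.
Proof.
move=> [p [xp py pn]]; exists (rev (belast x p)); split.
- rewrite -py rev_path; apply: sub_path xp => a b /=.
  by rewrite adj_sym.
- by case: p {xp pn} py => [|a p] /= py; [rewrite -py|rewrite rev_cons last_rcons].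
- by rewrite size_rev size_belast.
Qed.

Lemma walk0 x : is_walk x x 0.
Proof. by exists [::]. Qed.

Lemma walk1 x y : adj x y -> is_walk x y 1.
Proof. by move=> xy; exists [:: y]; rewrite /= xy. Qed.

Lemma gdistC x y : gdist x y = gdist y x.
Proof.
by apply/eqP; rewrite eqn_leq; apply/andP; split;
  apply: gdist_le; apply: walk_rev; apply: gdist_walk.
Qed.

Lemma gdist_triangle x y z : (gdist x z <= gdist x y + gdist y z)%N.
Proof. by apply: gdist_le; apply: walk_cat; apply: gdist_walk. Qed.

Lemma gdistxx x : gdist x x = 0%N.
Proof. by apply/eqP; rewrite -leqn0; apply: gdist_le; apply: walk0. Qed.

Lemma gdist_eq0 x y : (gdist x y == 0%N) = (x == y).
Proof.
apply/eqP/eqP => [d0|->]; last exact: gdistxx.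
by have := gdist_walk x y; rewrite d0 => -[[|a p] [_ /= <- sz]].
Qed.

Lemma gdist_adj x y : adj x y -> (gdist x y <= 1)%N.
Proof. by move=> xy; apply: gdist_le; apply: walk1. Qed.

(** A shortest walk is shortest between any two of its points: by the triangle inequality through
    [q i] and [q j], a shortcut would shorten the whole walk. *)
Lemma geodesic x y : exists q : nat -> G,
  [/\ q 0%N = x, q (gdist x y) = y,
      forall i, (i < gdist x y)%N -> adj (q i) (q i.+1) &
      forall i j, (i <= j <= gdist x y)%N -> gdist (q i) (q j) = (j - i)%N].
Proof.
have [p [xp py pn]] := gdist_walk x y.
exists (nth x (x :: p)).
have q0 : nth x (x :: p) 0 = x by [].
have qn : nth x (x :: p) (gdist x y) = y.
  by rewrite -pn nth_last.
have qa i : (i < gdist x y)%N -> adj (nth x (x :: p) i) (nth x (x :: p) i.+1).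
  by rewrite -pn; move=> ip; move/pathP: xp; apply.
split=> // i j /andP[ij jn].
have qw k l : (k + l <= gdist x y)%N ->
    is_walk (nth x (x :: p) k) (nth x (x :: p) (k + l)) l.
  elim: l => [|l IH] kl; first by rewrite addn0; exact: walk0.
  rewrite addnS in kl *; rewrite -[l.+1]addn1.
  by apply: walk_cat (IH (ltnW kl)) _; apply: walk1; apply: qa.
apply/eqP; rewrite eqn_leq; apply/andP; split.
  by apply: gdist_le; have := qw i (j - i)%N; rewrite subnKC //; apply.
have h1 : (gdist x (nth x (x :: p) i) <= i)%N.
  by apply: gdist_le; have := qw 0%N i; rewrite add0n; apply; lia.
have h2 : (gdist (nth x (x :: p) j) y <= gdist x y - j)%N.
  by apply: gdist_le; have := qw j (gdist x y - j)%N; rewrite subnKC // qn; apply.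
have := gdist_triangle x (nth x (x :: p) j) y.
have := gdist_triangle x (nth x (x :: p) i) (nth x (x :: p) j).
lia.
Qed.

Lemma path_invariant (P : G -> Prop) x y :
  P x -> (forall a b, P a -> adj a b -> P b) -> P y.
Proof.
move=> Px Pstep; have [p [xp <-]] := vertex_connected x y.
elim: p x Px xp => [//|b p IH] a Pa /= /andP[ab bp].
by apply: IH bp; apply: Pstep ab.
Qed.

Lemma exists_adj x : exists y, adj x y.
Proof.
have [y yx] : exists y, x <> y.
  apply: contrapT => /forallNP H; apply: (@vertex_infinite _ G).
  by apply: (@sub_finite_set _ _ [set x]) => // y _; apply: contrapT => yx; apply: (H y) => xy; apply: yx.
have [[|z p] [/= xp py]] := vertex_connected x y; first by case: yx.
by exists z; case/andP: xp.
Qed.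

End GraphDistance.

(** * Laplacian and Green functions *)

Section ControlledWeights.
Context {R : realType} (G : wgraph R).
Context (p0 : R) (p0_gt0 : 0 < p0).
Context (p0P : forall x y : G, adj x y -> p0 <= trans x y).
Implicit Types (x y z : G) (D S : seq G) (f g h k : G -> R).

(** Were mu(x) zero or infinite, [fine] and the convention 0^-1 = 0 would make every transition
    probability from x vanish, against the bound [p0] at some neighbour. *)
Lemma mu_fine_gt0 x : 0 < fine (mu x).
Proof.
have mu0 : (0 <= mu x)%E by apply: esum_ge0 => y _; rewrite lee_fin weight_ge0.
rewrite lt_def fine_ge0 // andbT; apply/eqP => m0.
have [y xy] := exists_adj x; have := p0P xy.
by rewrite /trans m0 invr0 mulr0 leNgt p0_gt0.
Qed.

Definition nbset x : set G := [set y | adj x y].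

Lemma mu_fin_num x : mu x \is a fin_num.
Proof.
have := mu_fine_gt0 x; rewrite /fine.
by case: (mu x) => //= [|]; rewrite ltxx.
Qed.

Lemma weight_lower x y : adj x y -> p0 * fine (mu x) <= weight x y.
Proof.
by move=> xy; rewrite -ler_pdivlMr ?mu_fine_gt0//; apply: p0P.
Qed.

Lemma nbset_finite x : finite_set (nbset x).
Proof.
apply: contrapT => inf.
(* More than 1 / p0 neighbours, each carrying at least the fraction p0 of mu(x), would exceed
   mu(x). *)
pose k := (Num.truncn (p0^-1)).+1.
have [F Fsub kF] := infinite_set_fset k inf.
have : ((\sum_(y <- F) weight x y)%:E <= mu x)%E.
  rewrite -sumEFin; apply: esum_ge; exists [set` F].
    by split => //.
  by rewrite fsbig_finite //= set_fsetK.
rewrite -[mu x]fineK ?mu_fin_num// lee_fin leNgt => /negP; apply.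
apply: (@lt_le_trans _ _ (\sum_(y <- F) (p0 * fine (mu x)))); last first.
  rewrite big_seq [leRHS]big_seq; apply: ler_sum => y yF.
  by apply: weight_lower; apply: Fsub.
rewrite big_const_seq count_predT iter_addr_0 -mulr_natl.
rewrite mulrA -[ltLHS]mul1r ltr_pM2r ?mu_fine_gt0// -ltr_pdivrMr// div1r.
apply: (lt_le_trans (truncnS_gt _)).
by rewrite ler_nat.
Qed.

Definition nb x : seq G := fset_set (nbset x).

Lemma mem_nb x y : (y \in nb x) = adj x y.
Proof.
rewrite /nb in_fset_set; last exact: nbset_finite.
by apply/idP/idP => [/set_mem|xy]; [|apply/mem_set].
Qed.

Lemma nb_uniq x : uniq (nb x).
Proof. exact: fset_uniq. Qed.

Definition deg x : R := fine (mu x).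

Lemma degE x : deg x = \sum_(y <- nb x) weight x y.
Proof.
rewrite /deg /mu esum_fset; first last.
- by move=> y _; rewrite lee_fin weight_ge0.
- exact: nbset_finite.
by rewrite fsbig_finite /= ?sumEFin //; exact: nbset_finite.
Qed.

Lemma deg_gt0 x : 0 < deg x.
Proof. exact: mu_fine_gt0. Qed.
#[local] Hint Resolve deg_gt0 : core.

Lemma muE x : mu x = (deg x)%:E.
Proof. by rewrite /deg fineK // mu_fin_num. Qed.

Lemma gball_finite x r : finite_set (gball x r).
Proof.
have fin n : finite_set [set y | (gdist x y <= n)%N].
  elim: n => [|n IH].
    apply: (@sub_finite_set _ _ [set x]) => // y /=.
    by rewrite leqn0 gdist_eq0 => /eqP.
  apply: (@sub_finite_set _ _ ([set y | (gdist x y <= n)%N] `|`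
     \bigcup_(z in [set y | (gdist x y <= n)%N]) nbset z)).
    move=> y /= yn; case: (leqP (gdist x y) n) => [|yn']; first by left.
    right; have dE : gdist x y = n.+1 by lia.
    have [q [q0 qe qa qd]] := geodesic x y.
    exists (q n); last by rewrite /nbset /= -qe dE; apply: qa; rewrite dE.
    by rewrite /= -q0 qd // ?dE; lia.
  rewrite finite_setU; split=> //; apply: bigcup_finite => // z _.
  exact: nbset_finite.
apply: sub_finite_set (fin (Num.truncn `|r|).+1) => y /= yr.
rewrite -(ler_nat R); apply/ltW/(lt_le_trans yr)/(le_trans (ler_norm _)).
exact/ltW/truncnS_gt.
Qed.

(** Balls are finite and the graph is not, so some vertex is at distance at least n; a geodesic to
    it meets the sphere of radius n. *)
Lemma exists_dist x n : exists y, gdist x y = n.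
Proof.
have [y yn] : exists y, (n <= gdist x y)%N.
  apply: contrapT => /forallNP H; apply: (@vertex_infinite _ G).
  apply: sub_finite_set (gball_finite x n%:R) => y _.
  by rewrite /gball /= ltr_nat ltnNge; apply/negP/H.
have [q [q0 _ _ qd]] := geodesic x y.
by exists (q n); rewrite -{1}q0 qd ?subn0.
Qed.

(** This is -Delta multiplied by mu: it is symmetric for unweighted sums, and superharmonic means
    [0 <= lap f]. *)
Definition lap f x : R := \sum_(y <- nb x) weight x y * (f x - f y).

(* Sums over pairs in [closed_nbhd D] see every edge that meets D. *)
Definition closed_nbhd D : seq G := undup (D ++ flatten [seq nb x | x <- D]).

Lemma sum_nb S x (F : G -> R) : uniq S -> {subset nb x <= S} ->
  \sum_(y <- S) weight x y * F y = \sum_(y <- nb x) weight x y * F y.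
Proof.
move=> uS nS; rewrite (bigID (mem (nb x))) /= [X in _ + X]big1 ?addr0; last first.
  by move=> y; rewrite mem_nb => /weight_nadj ->; rewrite mul0r.
rewrite -big_filter; apply: perm_big; apply: uniq_perm.
- exact: filter_uniq.
- exact: nb_uniq.
- move=> y; rewrite mem_filter; case: (boolP (y \in nb x)) => // /nS.
  by move=> /= ->.
Qed.

Lemma lap_sum S f x : uniq S -> {subset nb x <= S} ->
  \sum_(y <- S) weight x y * (f x - f y) = lap f x.
Proof. exact: sum_nb. Qed.

Lemma closed_nbhd_nb D x : x \in D -> {subset nb x <= closed_nbhd D}.
Proof.
move=> xD y yx; rewrite mem_undup mem_cat; apply/orP; right.
by apply/flatten_mapP; exists x.
Qed.

Lemma closed_nbhd_sub D : {subset D <= closed_nbhd D}.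
Proof. by move=> x xD; rewrite mem_undup mem_cat xD. Qed.

Lemma lap_lin (a : R) f k x :
  lap (fun y => a * f y + k y) x = a * lap f x + lap k x.
Proof. by rewrite /lap mulr_sumr -big_split /=; apply: eq_bigr => y _; ring. Qed.

Lemma lap_cst (a : R) x : lap (fun=> a) x = 0.
Proof. by rewrite /lap big1 // => y _; rewrite subrr mulr0. Qed.

Lemma markov_opE f x : markov_op f x = \sum_(y <- nb x) trans x y * f y.
Proof.
rewrite /markov_op (fsbigE (nb x)) //.
- by apply: eq_bigl => y; rewrite in_setT.
- exact: nb_uniq.
- by move=> y _; rewrite mem_nb => /weight_nadj; rewrite /trans => ->; rewrite !mul0r.
Qed.

Lemma lap_markov f x : lap f x = deg x * (f x - markov_op f x).
Proof.
rewrite markov_opE mulrBr degE mulr_suml mulr_sumr -sumrB; apply: eq_bigr => y _.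
rewrite /trans -/(deg x); have := deg_gt0 x; rewrite degE => /gt_eqF/negbT d0.
by field.
Qed.

Lemma seq_max (D : seq G) f y : y \in D ->
  exists2 z, z \in D & forall w, w \in D -> f w <= f z.
Proof.
elim: D y => // a [|b D] IH y _.
  by exists a; rewrite ?mem_head // => w; rewrite inE => /eqP ->.
have [z zD zmax] := IH b (mem_head _ _).
have [az|za] := leP (f a) (f z).
  exists z; first by rewrite inE zD orbT.
  by move=> w; rewrite inE => /predU1P[->//|]; apply: zmax.
exists a; first exact: mem_head.
by move=> w; rewrite inE => /predU1P[->//|/zmax wz]; apply: le_trans (ltW za).
Qed.

(** At a maximum over D exceeding M, subharmonicity forces the same value on all neighbours, which
    must then lie in D. By connectedness D would be the whole infinite graph. *)
Lemma max_principle D f (M : R) :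
  (forall y, y \in D -> lap f y <= 0) ->
  (forall x y, x \in D -> adj x y -> y \notin D -> f y <= M) ->
  forall y, y \in D -> f y <= M.
Proof.
move=> sub bd y0 y0D; rewrite leNgt; apply/negP => My0.
have [z zD zmax] := seq_max f y0D.
have Mz : M < f z := lt_le_trans My0 (zmax _ y0D).
have all_in y : y \in D /\ f y = f z.
  apply: (path_invariant (P := fun y => y \in D /\ f y = f z) (x := z)) => // a b [aD faz] ab.
  have nb_le w : adj a w -> f w <= f z.
    move=> aw; case: (boolP (w \in D)) => [/zmax//|wD].
    exact: le_trans (bd _ _ aD aw wD) (ltW Mz).
  have ge0 w : w \in nb a -> 0 <= weight a w * (f a - f w).
    by rewrite mem_nb => aw; rewrite mulr_ge0 ?weight_ge0 // subr_ge0 faz nb_le.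
  have /eqP : \sum_(w <- nb a | w \in nb a) weight a w * (f a - f w) == 0.
    rewrite -big_seq eq_le (sub a aD) /=.
    by rewrite /lap big_seq; apply: sumr_ge0.
  move/eqP; rewrite psumr_eq0 // => /allP /(_ b); rewrite mem_nb ab.
  move=> /(_ isT) /=; rewrite mulf_eq0 gt_eqF //= subr_eq0 => /eqP fab.
  split; last by rewrite -fab.
  case: (boolP (b \in D)) => // bD; have := bd _ _ aD ab bD.
  by rewrite leNgt -fab faz Mz.
apply: (@vertex_infinite _ G); apply: (@sub_finite_set _ _ [set` D]) => [y _|].
  by have [] := all_in y.
exact: finite_seq.
Qed.

Lemma min_principle D f (M : R) :
  (forall y, y \in D -> 0 <= lap f y) ->
  (forall x y, x \in D -> adj x y -> y \notin D -> M <= f y) ->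
  forall y, y \in D -> M <= f y.
Proof.
move=> sup bd y yD.
have /max_principle mp : forall y, y \in D -> lap (fun z => (-1) * f z + (fun=> 0) z) y <= 0.
  by move=> z zD; rewrite lap_lin lap_cst addr0 mulN1r oppr_le0 sup.
have := mp (- M) _ y yD; rewrite mulN1r addr0 lerN2; apply.
by move=> a b aD ab bD; rewrite mulN1r addr0 lerN2; apply: bd ab bD.
Qed.

(** A square linear system on the functions vanishing off D: the maximum and minimum principles make
    its kernel trivial, so it is invertible. *)
Lemma poisson D f : uniq D ->
  exists h, (forall y, y \notin D -> h y = 0) /\
            (forall y, y \in D -> lap h y = f y).
Proof.
move=> uD; set n := size D.
pose ext (c : 'rV[R]_n) (y : G) : R :=
  \sum_(j < n) (tnth (in_tuple D) j == y)%:R * c 0 j.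
have ext_off c y : y \notin D -> ext c y = 0.
  move=> yD; rewrite /ext big1 // => j _; case: eqP => [e|]; rewrite ?mul0r //.
  by case/negP: yD; rewrite -e; exact: mem_tnth.
have ext_on c j : ext c (tnth (in_tuple D) j) = c 0 j.
  rewrite /ext (bigD1 j) //= eqxx mul1r big1 ?addr0 // => i ij.
  case: eqP => [e|]; rewrite ?mul0r //; case/negP: ij; apply/eqP.
  by have /tuple_uniqP := (uD : uniq (in_tuple D)); apply.
have ext_lin a c c' y : ext (a *: c + c') y = a * ext c y + ext c' y.
  rewrite /ext mulr_sumr -big_split /=; apply: eq_bigr => j _.
  by rewrite !mxE; ring.
pose T (c : 'rV[R]_n) : 'rV[R]_n := \row_i lap (ext c) (tnth (in_tuple D) i).
have Tlin : linear T.
  move=> a c c'; apply/rowP => i; rewrite !mxE -lap_lin.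
  by apply: eq_bigr => y _; rewrite !ext_lin.
pose Tl : {linear 'rV[R]_n -> 'rV[R]_n} :=
  HB.pack T (GRing.isLinear.Build _ _ _ _ T Tlin).
have Tinj : row_free (lin1_mx Tl).
  apply: inj_row_free => c; rewrite mul_rV_lin1 => /rowP Tc0.
  have l0 y : y \in D -> lap (ext c) y = 0.
    by move=> /(tnthP (in_tuple D))[i ->]; have := Tc0 i; rewrite !mxE.
  have e0 y : y \in D -> ext c y = 0.
    move=> yD; apply/eqP; rewrite eq_le; apply/andP; split.
      apply: (max_principle (D := D)) => // [z zD|a b _ _ bD].
        by rewrite l0.
      by rewrite ext_off.
    apply: (min_principle (D := D)) => // [z zD|a b _ _ bD].
      by rewrite l0.
    by rewrite ext_off.
  by apply/rowP => i; rewrite mxE -ext_on e0 //; exact: mem_tnth.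
pose c := (\row_i f (tnth (in_tuple D) i)) *m invmx (lin1_mx Tl).
exists (ext c); split=> [y|y]; first exact: ext_off.
move=> /(tnthP (in_tuple D))[i ->].
have /rowP /(_ i) : Tl c = \row_i f (tnth (in_tuple D) i).
  by rewrite -mul_rV_lin1 /c mulmxKV // -row_free_unit.
by rewrite !mxE.
Qed.

(** * Energy, summation by parts and Green functions of finite sets *)

Definition energy S f k : R :=
  \sum_(p <- S) \sum_(q <- S) weight p q * (f p - f q) * (k p - k q).

Lemma sum_supp S D (F : G -> R) : uniq S -> uniq D -> {subset D <= S} ->
  (forall y, y \notin D -> F y = 0) -> \sum_(y <- S) F y = \sum_(y <- D) F y.
Proof.
move=> uS uD DS F0; rewrite (bigID (mem D)) /= [X in _ + X]big1 ?addr0; last first.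
  by move=> y; apply: F0.
rewrite -big_filter; apply: perm_big; apply: uniq_perm => //.
- exact: filter_uniq.
- move=> y; rewrite mem_filter; case: (boolP (y \in D)) => // /DS.
  by move=> /= ->.
Qed.

(** Discrete Green formula. The factor 2 comes from summing over ordered pairs; there is no boundary
    term because k vanishes off D. *)
Lemma energyE D f k : uniq D -> (forall y, y \notin D -> k y = 0) ->
  energy (closed_nbhd D) f k = 2 * \sum_(p <- D) k p * lap f p.
Proof.
move=> uD k0; set S := closed_nbhd D; have uS : uniq S by apply: undup_uniq.
have -> : energy S f k = 2 * \sum_(p <- S) \sum_(q <- S) weight p q * (f p - f q) * k p.
  rewrite mulrDl mul1r [X in _ = X + _]exchange_big /= -big_split /=.
  rewrite [LHS]exchange_big /=; apply: eq_bigr => p _.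
  rewrite -big_split /=; apply: eq_bigr => q _.
  rewrite (weight_sym q p); ring.
congr (_ * _).
have DS : {subset D <= S} by exact: closed_nbhd_sub.
rewrite (sum_supp uS uD DS) => [|y yD]; last first.
  by rewrite big1 // => q _; rewrite k0 // mulr0.
rewrite !big_seq; apply: eq_bigr => p pD.
rewrite -mulr_suml mulrC lap_sum //; exact: closed_nbhd_nb.
Qed.

Lemma lap_symm D f k : uniq D -> (forall y, y \notin D -> f y = 0) ->
  (forall y, y \notin D -> k y = 0) ->
  \sum_(p <- D) k p * lap f p = \sum_(p <- D) f p * lap k p.
Proof.
move=> uD f0 k0; apply: (@mulfI _ 2); first by rewrite pnatr_eq0.
rewrite -!energyE //; apply: eq_bigr => p _; apply: eq_bigr => q _; ring.
Qed.

(** An edge with both ends off D contributes nothing, and any other edge joins two points of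
    [closed_nbhd D], so the infinite sum is a finite one. *)
Lemma dirichletE D f : uniq D -> (forall y, y \notin D -> f y = 0) ->
  dirichlet f = (2^-1 * energy (closed_nbhd D) f f)%:E.
Proof.
move=> uD f0; rewrite /dirichlet EFinM; congr (_ * _)%E.
set S := closed_nbhd D; have uS : uniq S by apply: undup_uniq.
pose P := [seq (p, q) | p <- S, q <- S].
have uP : uniq P by apply: allpairs_uniq => // -[a b] [a' b'].
pose F (p : G * G) := weight p.1 p.2 * (f p.1 - f p.2) ^+ 2.
have F_ge0 p : 0 <= F p by rewrite mulr_ge0 ?weight_ge0 ?sqr_ge0.
have F0 p : p \notin P -> F p = 0.
  case: p => a b; rewrite /F /= => nP.
  case: (boolP (adj a b)) => [ab|/weight_nadj ->]; last by rewrite mul0r.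
  have [aD|aD] := boolP (a \in D).
    case/negP: nP; apply: allpairs_f; first exact: closed_nbhd_sub.
    by apply: (closed_nbhd_nb aD); rewrite mem_nb.
  have [bD|bD] := boolP (b \in D).
    case/negP: nP; apply: allpairs_f; last exact: closed_nbhd_sub.
    by apply: (closed_nbhd_nb bD); rewrite mem_nb adj_sym.
  by rewrite !f0 // subrr expr0n mulr0.
transitivity (\esum_(p in [set` P]) (F p)%:E)%E.
  rewrite (esum_mkcond [set` P]); apply: eq_esum => p _.
  case: ifPn => // nP; rewrite -/(F p) F0 //.
  by apply: contra nP => pP; apply/mem_set.
rewrite esum_fset; first last.
- by move=> p _; rewrite lee_fin.
- exact: finite_seq.
rewrite -fsbig_seq // sumEFin /P big_allpairs; congr (_ %:E).
apply: eq_bigr => p _; apply: eq_bigr => q _; rewrite /F /=; ring.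
Qed.

(* [xget] picks the unique solution, which exists by [poisson] when D is duplicate-free. *)
Definition green D x : G -> R :=
  xget (fun=> 0) [set g | (forall y, y \notin D -> g y = 0) /\
                          (forall y, y \in D -> lap g y = (y == x)%:R)].

Section Green.
Context (D : seq G) (uD : uniq D).

Lemma green_spec x : (forall y, y \notin D -> green D x y = 0) /\
  (forall y, y \in D -> lap (green D x) y = (y == x)%:R).
Proof.
have [h hP] := poisson (fun y => (y == x)%:R) uD.
exact: (xgetPex (P := [set g | _]) (fun=> 0) (ex_intro _ h hP)).
Qed.

Lemma green_off x y : y \notin D -> green D x y = 0.
Proof. exact: (green_spec x).1. Qed.

Lemma lap_green x y : y \in D -> lap (green D x) y = (y == x)%:R.
Proof. exact: (green_spec x).2. Qed.

Lemma green_ge0 x y : 0 <= green D x y.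
Proof.
have [yD|/green_off ->//] := boolP (y \in D).
apply: (min_principle (D := D)) yD => [z zD|a b _ _ bD].
  by rewrite lap_green.
by rewrite green_off.
Qed.

Lemma green_eval x (xD : x \in D) k : \sum_(p <- D) k p * lap (green D x) p = k x.
Proof.
rewrite (bigD1_seq x) //= lap_green // eqxx mulr1 big_seq_cond big1 ?addr0 // => y.
by case/andP => yD yx; rewrite lap_green // (negbTE yx) mulr0.
Qed.

Lemma green_pairing x k : x \in D -> (forall y, y \notin D -> k y = 0) ->
  \sum_(p <- D) green D x p * lap k p = k x.
Proof.
by move=> xD k0; rewrite -lap_symm ?green_eval //; exact: green_off.
Qed.

(** Evaluation at y is pairing with the point mass [lap (green D y)], and [lap] is self-adjoint on
    functions vanishing off D. *)
Lemma green_sym x y : x \in D -> y \in D -> green D x y = green D y x.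
Proof.
move=> xD yD; rewrite -(green_pairing yD (k := green D x)); last exact: green_off.
rewrite (lap_symm uD); [|exact: green_off|exact: green_off].
by rewrite green_pairing //; exact: green_off.
Qed.

End Green.

(** * Mean exit time *)

Section ExitTime.
Context (D : seq G) (uD : uniq D).

Definition killed_op f y : R := \sum_(z <- D) trans y z * f z.

(** For y in D this is the probability that the walk from y stays in D up to time n. Off D it has no
    such meaning: the value at time 0 is 1 everywhere. *)
Definition survival n y : R := iter n killed_op (fun=> 1) y.

Lemma survivalS n y : survival n.+1 y = killed_op (survival n) y.
Proof. by []. Qed.

Lemma trans_ge0 y z : 0 <= trans y z.
Proof. by rewrite mulr_ge0 ?weight_ge0 // invr_ge0 ltW //; exact: deg_gt0. Qed.

Lemma killed_op_le f k y : (forall z, z \in D -> f z <= k z) ->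
  killed_op f y <= killed_op k y.
Proof.
move=> fk; rewrite /killed_op big_seq [leRHS]big_seq.
by apply: ler_sum => z zD; rewrite ler_wpM2l ?trans_ge0 ?fk.
Qed.

Lemma killed_opE f y : (forall z, z \notin D -> f z = 0) ->
  killed_op f y = markov_op f y.
Proof.
move=> f0; rewrite markov_opE /killed_op.
have -> : \sum_(z <- nb y) trans y z * f z = \sum_(z <- nb y | z \in D) trans y z * f z.
  rewrite [LHS](bigID (mem D)) /= [X in _ + X]big1 ?addr0 // => z zD.
  by rewrite f0 // mulr0.
have -> : \sum_(z <- D) trans y z * f z = \sum_(z <- D | z \in nb y) trans y z * f z.
  rewrite [LHS](bigID (mem (nb y))) /= [X in _ + X]big1 ?addr0 // => z.
  by rewrite mem_nb => /weight_nadj; rewrite /trans => ->; rewrite !mul0r.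
rewrite -big_filter -[RHS]big_filter; apply: perm_big; apply: uniq_perm.
- exact: filter_uniq.
- by apply: filter_uniq; exact: nb_uniq.
- by move=> z; rewrite !mem_filter andbC.
Qed.

Lemma survival_ge0 n y : 0 <= survival n y.
Proof.
elim: n y => [|n IH] y; [exact: ler01|rewrite survivalS sumr_ge0 // => z _].
by rewrite mulr_ge0 ?trans_ge0.
Qed.

(** * The torsion function of D and the survival series *)

Section Torsion.
Context (h : G -> R) (h_off : forall y, y \notin D -> h y = 0).
Context (h_on : forall y, y \in D -> lap h y = deg y).

Lemma torsion_ge0 y : 0 <= h y.
Proof.
have [yD|/h_off ->//] := boolP (y \in D).
apply: (min_principle (D := D)) yD => [z zD|a b _ _ bD].
  by rewrite h_on // ltW.
by rewrite h_off.
Qed.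

Lemma torsion_step y : y \in D -> h y = 1 + killed_op h y.
Proof.
move=> yD; rewrite killed_opE //; have := h_on yD; rewrite lap_markov => e.
have {}e : h y - markov_op h y = 1.
  by apply: (mulfI (lt0r_neq0 (deg_gt0 y))); rewrite e mulr1.
by rewrite -e subrK.
Qed.

Lemma torsion_partial N y : y \in D ->
  h y = \sum_(0 <= n < N) survival n y + iter N killed_op h y.
Proof.
elim: N y => [|N IH] y yD; first by rewrite big_nil add0r.
rewrite torsion_step // big_nat_recl //= -addrA; congr (_ + _).
have -> : \sum_(0 <= n < N) survival n.+1 y =
    \sum_(z <- D) \sum_(0 <= n < N) trans y z * survival n z.
  by rewrite exchange_big.
rewrite -big_split /= /killed_op.
rewrite !big_seq; apply: eq_bigr => z zD; rewrite (IH z zD) mulrDr.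
by congr (_ + _); rewrite mulr_sumr.
Qed.

(** Unrolling h = 1 + Q h, with Q the killed operator, leaves the remainder Q^N h, at most max h
    times [survival N]. The partial sums are bounded by h, so the survival series converges, its
    terms tend to 0, and so does the remainder. *)
Lemma survival_sum y : y \in D ->
  (\sum_(0 <= n <oo) (survival n y)%:E)%E = (h y)%:E.
Proof.
move=> yD.
have k_ge0 N z : 0 <= iter N killed_op h z.
  case: N => [|N] /=; first exact: torsion_ge0.
  elim: N z => [|N IH] z /=.
    by apply: sumr_ge0 => w _; rewrite mulr_ge0 ?trans_ge0 ?torsion_ge0.
  by apply: sumr_ge0 => w _; rewrite mulr_ge0 ?trans_ge0.
pose M := \sum_(z <- D) h z.
have hM z : z \in D -> h z <= M.
  move=> zD; rewrite /M (bigD1_seq z) //= lerDl; apply: sumr_ge0 => w _.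
  exact: torsion_ge0.
have M_ge0 : 0 <= M by apply: sumr_ge0 => w _; exact: torsion_ge0.
have kM N z : z \in D -> iter N killed_op h z <= M * survival N z.
  elim: N z => [|N IH] z zD /=; first by rewrite mulr1; exact: hM.
  apply: (le_trans (killed_op_le z IH)); rewrite /killed_op mulr_sumr.
  by apply: ler_sum => w _; rewrite mulrCA.
have cs : cvgn (series (survival^~ y)).
  apply: nondecreasing_is_cvgn.
    apply: nondecreasing_series => n _ _; exact: survival_ge0.
  exists (h y) => _ [N _ <-]; rewrite /series /= (torsion_partial N yD) lerDl.
  exact: k_ge0.
have c0 := cvg_series_cvg_0 cs.
have kc : (fun N => iter N killed_op h y) @ \oo --> (0 : R).
  apply: (@squeeze_cvgr _ _ _ _ (fun=> 0) (fun N => M * survival N y)).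
  - by near=> N; rewrite k_ge0 kM.
  - exact: cvg_cst.
  - by rewrite -[X in _ --> X](mulr0 M); apply: cvgM; [exact: cvg_cst|exact: c0].
have sc : series (survival^~ y) @ \oo --> h y.
  have -> : series (survival^~ y) = (fun N => h y - iter N killed_op h y).
    apply/funext => N; rewrite /series /= (torsion_partial N yD).
    by rewrite addrK.
  rewrite -[X in _ --> X](subr0 (h y)); apply: cvgB kc; exact: cvg_cst.
rewrite -(cvg_lim _ sc) // -EFin_lim //.
by congr (limn _); apply/funext => N /=; rewrite /series /= sumEFin.
Unshelve. all: by end_near. Qed.

End Torsion.

(** * From the law of the walk to its mean exit time *)

Context (d : measure_display) (Omega : measurableType d).
Context (Pr : G -> probability Omega R) (X : nat -> Omega -> G).
Context (hX : random_walk Pr X).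

(** The path is prescribed up to time n and only confined to D for the next m steps; this
    interpolates between the events of [rw_markov] and survival. *)
Let cylinder n m (p : nat -> G) : set Omega :=
  [set w | (forall i, (i <= n)%N -> X i w = p i) /\
           (forall i, (n < i <= n + m)%N -> X i w \in D)].

Lemma preimage_measurable n (s : seq G) : measurable [set w | X n w \in s].
Proof.
have -> : [set w | X n w \in s] = \bigcup_(y in [set` s]) (X n @^-1` [set y]).
  by apply/seteqP; split => [w ws|w [y ys] /= ->]; [exists (X n w)|].
apply: fin_bigcup_measurable; first exact: finite_seq.
by move=> y _; exact: (rw_measurable hX).
Qed.

Lemma survive_measurable n : measurable [set w | forall i, (i <= n)%N -> X i w \in D].
Proof.
have -> : [set w | forall i, (i <= n)%N -> X i w \in D] =
    \bigcap_(i in [set i | (i <= n)%N]) [set w | X i w \in D] by [].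
by apply: bigcap_measurableType => i _; exact: preimage_measurable.
Qed.

Let cylinder_measurable n m p : measurable (cylinder n m p).
Proof.
have -> : cylinder n m p =
    (\bigcap_(i in [set i | (i <= n)%N]) (X i @^-1` [set p i])) `&`
    (\bigcap_(i in [set i | (n < i <= n + m)%N]) [set w | X i w \in D]) by [].
apply: measurableI; apply: bigcap_measurableType => i _.
  exact: (rw_measurable hX).
exact: preimage_measurable.
Qed.

Let cylinder_prob x n m (p : nat -> G) :
  Pr x (cylinder n m p) = (Pr x (cylinder n 0 p) * (survival m (p n))%:E)%E.
Proof.
elim: m n p => [|m IH] n p; first by rewrite mule1.
(* Only the value y at time n + 1 matters: splitting over it trades one confined step for a
   prescribed one. *)
pose p' y i := if (i <= n)%N then p i else y.
have -> : cylinder n m.+1 p = \bigcup_(y in [set` D]) cylinder n.+1 m (p' y).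
  apply/seteqP; split=> [w [wp wD]|w [y yD [wp wD]]].
    exists (X n.+1 w); first by apply: wD; lia.
    split=> i ni; last by apply: wD; lia.
    by rewrite /p'; case: ifPn => i_n; [exact: wp|congr (X _ w); lia].
  split=> i ni; first by have := wp i; rewrite /p' ni; apply; lia.
  have [i_n|i_n] := leqP i n.+1; last by apply: wD; lia.
  by rewrite wp // /p' ifF //; lia.
rewrite measure_fin_bigcup; first last.
- by move=> y _; exact: cylinder_measurable.
- move=> y z _ _ [w [[wy _] [wz _]]].
  have := wy _ (leqnn n.+1); have := wz _ (leqnn n.+1).
  by rewrite /p' ltnn => -> ->.
- exact: finite_seq.
rewrite -fsbig_seq // survivalS /killed_op.
have cyl0 (k : nat) q : cylinder k 0 q = [set w | forall i, (i <= k)%N -> X i w = q i].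
  apply/seteqP; split=> [w []//|w wq]; split=> // i; lia.
transitivity (\sum_(y <- D) (Pr x (cylinder n 0 p) * (trans (p n) y * survival m y)%:E))%E.
  apply: eq_bigr => y _; etransitivity; [exact: IH|]; rewrite cyl0 (rw_markov hX) /p' leqnn ltnn EFinM.
  rewrite -muleA; congr (_ * _)%E; congr (Pr x _).
  rewrite cyl0; apply/seteqP; split=> w /= wp i ni; have := wp i ni; rewrite ni //.
by rewrite -ge0_sume_distrr // ?sumEFin // => y _; rewrite lee_fin mulr_ge0 ?trans_ge0 ?survival_ge0.
Qed.

(** The walk starts at x only almost surely, so the survival event and the cylinder started at x
    agree up to a null set. *)
Lemma survive_prob x n : x \in D ->
  Pr x [set w | forall i, (i <= n)%N -> X i w \in D] = (survival n x)%:E.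
Proof.
move=> xD.
have start : cylinder 0 0 (fun=> x) = X 0%N @^-1` [set x].
  apply/seteqP; split=> [w [wx _]|w wx]; first exact: wx.
  split=> i; last by lia.
  by rewrite leqn0 => /eqP ->.
transitivity (Pr x (cylinder 0 n (fun=> x))); last first.
  by rewrite cylinder_prob start (rw_start hX) mul1e.
apply: le_anti; apply/andP; split; last first.
  apply: le_measure; rewrite ?inE //; first exact: survive_measurable.
  move=> w [w0 wD] i i_n; case: i i_n => [|i] i_n; first by rewrite w0.
  exact: wD.
have sx : measurable (X 0%N @^-1` [set x]) by exact: (rw_measurable hX).
have null : Pr x (~` (X 0%N @^-1` [set x])) = 0%E.
  by rewrite probability_setC // (rw_start hX) subee.
rewrite -[leRHS]adde0 -null.
apply: (le_trans _ (measureU2 _ _ _)) => //; last exact: measurableC.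
apply: le_measure; rewrite ?inE //; first exact: survive_measurable.
  by apply: measurableU => //; exact: measurableC.
move=> w wD; have [w0|w0] := pselect (X 0%N w = x); last by right.
left; split=> [i|i i_n]; last by apply: wD; lia.
by rewrite leqn0 => /eqP ->.
Qed.

(** T is the sum over n of the indicators of {T > n}. If the walk never leaves D, the infimum of the
    empty set and the divergent series are both +oo. *)
Lemma exit_time_series w : exit_time X [set` D] w =
  (\sum_(0 <= n <oo) (\1_[set w | forall i, (i <= n)%N -> X i w \in D] w)%:E)%E.
Proof.
pose a n := ((\1_[set w | forall i, (i <= n)%N -> X i w \in D] w : R)%:E)%E.
have a_ge0 n : (0 <= a n)%E by rewrite lee_fin.
have a1 n : (forall i, (i <= n)%N -> X i w \in D) -> a n = 1%E.
  by move=> wn; rewrite /a indicE mem_set.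
have suma N : (forall i, (i < N)%N -> X i w \in D) -> (\sum_(0 <= n < N) a n)%E = (N%:R)%:E.
  move=> wN; rewrite (eq_big_nat _ _ (F2 := fun=> 1%:E)).
    by rewrite sumEFin sumr_const_nat subn0.
  by move=> n /andP[_ nN]; apply: a1 => i i_n; apply: wN; lia.
rewrite -/(a _) /exit_time.
have [[k wk]|stay] := pselect (exists k : nat, X k w \notin D); last first.
  have inD i : X i w \in D.
    by apply: contrapT => /negP iD; apply: stay; exists i.
  transitivity (+oo : \bar R)%E.
    rewrite (_ : [set _ | _ in _] = set0) ?ereal_inf0 //.
    by apply/seteqP; split => // t [j jD _]; apply: jD; exact: inD.
  apply/esym/eqyP => M M0.
  apply: (le_trans _ (nneseries_lim_ge (Num.truncn M).+1 _)) => //.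
  by rewrite suma // lee_fin; apply/ltW/truncnS_gt.
have [N wN Nmin] := ex_minnP (ex_intro (fun k : nat => X k w \notin D) k wk).
have inD i : (i < N)%N -> X i w \in D.
  by move=> iN; apply: contraT => /Nmin; lia.
rewrite (nneseries_split 0 N) // add0n suma // eseries0 ?adde0.
  apply: le_anti; apply/andP; split.
    by apply: ereal_inf_lbound; exists N => //; exact/negP.
  apply/ereal_infP => _ [j jD <-]; rewrite lee_fin ler_nat; apply: Nmin.
  exact/negP.
move=> n Nn _; rewrite /a indicE memNset // => wn.
by move: wN; rewrite wn.
Qed.

Lemma exit_time_torsion (h : G -> R) x : x \in D ->
  (forall y, y \notin D -> h y = 0) -> (forall y, y \in D -> lap h y = deg y) ->
  (\int[Pr x]_w exit_time X [set` D] w)%E = (h x)%:E.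
Proof.
move=> xD h_off h_on; rewrite -(survival_sum h_off h_on xD).
under eq_integral do rewrite exit_time_series.
rewrite integral_nneseries //.
- congr (limn _); apply/funext => N; apply: eq_bigr => n _.
  rewrite integral_indic ?setIT //; first exact: survive_prob.
  exact: survive_measurable.
- move=> n; apply/measurable_EFinP; apply: measurable_indic.
  exact: survive_measurable.
Qed.

(** The mean exit time is the torsion function h; pairing h with the Green function and using
    [lap h = deg] represents it as a sum. *)
Lemma exit_time_green x : x \in D ->
  (\int[Pr x]_w exit_time X [set` D] w)%E = (\sum_(y <- D) green D x y * deg y)%:E.
Proof.
move=> xD; have [h [h_off h_on]] := poisson deg uD.
rewrite (exit_time_torsion xD h_off h_on) -(green_pairing uD xD h_off).
by congr (_%:E); rewrite !big_seq; apply: eq_bigr => y yD; rewrite h_on.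
Qed.

End ExitTime.

(** * Resistance *)

Section Resistance.
Context (D : seq G) (uD : uniq D) (x : G) (xD : x \in D).
Let g := green D x.

(** The function min(g, a) / a is admissible. By [min_contracts] its energy is at most its energy
    pairing with g, divided by a, and that pairing evaluates it at x, where it is at most 1. *)
Lemma resistance_ge (A : set G) (a : R) : 0 < a -> (forall y, A y -> a <= g y) ->
  (a%:E <= resistance A (~` [set` D]))%E.
Proof.
move=> a0 gA; rewrite /resistance; set I := ereal_inf _.
pose f y := Num.min (g y) a / a.
have f_off y : y \notin D -> f y = 0.
  by move=> yD; rewrite /f /g green_off // min_l ?mul0r // ltW.
have f_le : (dirichlet f <= (a^-1)%:E)%E.
  rewrite (dirichletE uD f_off) lee_fin.
  apply: (@le_trans _ _ (2^-1 * (a^-1 * energy (closed_nbhd D) g f))).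
    rewrite ler_pM2l ?invr_gt0 // mulr_sumr; apply: ler_sum => p _.
    rewrite mulr_sumr; apply: ler_sum => q _.
    rewrite [leRHS](_ : _ = weight p q * ((g p - g q) / a * (f p - f q))); last by ring.
    rewrite -mulrA ler_wpM2l ?weight_ge0 // -subr_ge0 /f.
    set m := Num.min (g p) a; set m' := Num.min (g q) a.
    rewrite (_ : _ - _ = ((g p - g q) - (m - m')) * (m - m') * a^-1 ^+ 2); last by ring.
    by rewrite mulr_ge0 ?sqr_ge0 // min_contracts.
  rewrite energyE // (green_eval uD xD).
  have -> : 2^-1 * (a^-1 * (2 * f x)) = a^-1 * f x by field; lra.
  by rewrite ler_piMr ?invr_ge0 ?(ltW a0) // /f ler_pdivrMr // mul1r ge_min lexx orbT.
have inf_le : (I <= (a^-1)%:E)%E.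
  rewrite /I; apply: ge_ereal_inf; exists (dirichlet f) => //; exists f => //; split=> y.
    by move=> /gA ay; rewrite /f min_r // divff // gt_eqF.
  by move=> /negP; exact: f_off.
have inf_ge : (0 <= I)%E.
  rewrite /I; apply: le_ereal_inf_tmp => _ [u [_ u_off] <-]; rewrite mule_ge0 ?lee_fin ?invr_ge0 //.
  by apply: esum_ge0 => p _; rewrite lee_fin mulr_ge0 ?weight_ge0 ?sqr_ge0.
have <- : ((a^-1)%:E^-1 = a%:E :> \bar R)%E by rewrite inver invrK gt_eqF // invr_gt0.
by rewrite lee_pV2 // !inE // lee_fin invr_ge0 ltW.
Qed.

(** Every competitor f pairs with g to f(x) = 1, while g paired with min(g, b) gives at most b;
    completing a square then bounds the energy of f below by 1 / b. Neighbours enter the hypothesis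
    so that f is constant on every edge meeting {g > b}. *)
Lemma resistance_le (A : set G) (b : R) : 0 < b -> A x ->
  (forall p, b < g p -> A p /\ forall q, adj p q -> A q) ->
  (resistance A (~` [set` D]) <= b%:E)%E.
Proof.
move=> b0 Ax gA; rewrite /resistance; set I := ereal_inf _.
have <- : ((b^-1)%:E^-1 = b%:E :> \bar R)%E by rewrite inver invrK gt_eqF // invr_gt0.
have le_inf : ((b^-1)%:E <= I)%E.
  rewrite /I; apply: le_ereal_inf_tmp => _ [f [f1 f0] <-].
  have f_off y : y \notin D -> f y = 0 by move=> yD; apply: f0; apply/negP.
  rewrite (dirichletE uD f_off) lee_fin.
  pose k y := Num.min (g y) b.
  have k_off y : y \notin D -> k y = 0.
    by move=> yD; rewrite /k /g green_off // min_l // ltW.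
  (* Sum of df^2 >= 2 df dg / b - dk dg / b^2, where df = 0 on edges with an end in {g > b}. *)
  have : 2 / b * energy (closed_nbhd D) g f - b^-1 ^+ 2 * energy (closed_nbhd D) g k
      <= energy (closed_nbhd D) f f.
    rewrite !mulr_sumr -sumrB; apply: ler_sum => p _.
    rewrite !mulr_sumr -sumrB; apply: ler_sum => q _.
    have [pq|/weight_nadj ->] := boolP (adj p q); last by lra.
    rewrite [leLHS](_ : _ = weight p q * (2 / b * (g p - g q) * (f p - f q)
      - b^-1 ^+ 2 * ((g p - g q) * (k p - k q)))); last by ring.
    rewrite -[leRHS]mulrA ler_wpM2l ?weight_ge0 //.
    have mono : 0 <= b^-1 ^+ 2 * ((g p - g q) * (k p - k q)).
      by rewrite mulr_ge0 ?sqr_ge0 // min_monotone.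
    have [gp|gp] := ltP b (g p).
      have [/f1 -> /(_ _ pq) /f1 ->] := gA _ gp.
      by rewrite subrr !mulr0 sub0r oppr_le0.
    have [gq|gq] := ltP b (g q).
      have [/f1 -> Aq] := gA _ gq; rewrite (f1 p) ?subrr ?mulr0 ?sub0r ?oppr_le0 //.
      by apply: Aq; rewrite adj_sym.
    rewrite /k !min_l //.
    have := sqr_ge0 (f p - f q - b^-1 * (g p - g q)).
    by lra.
  rewrite !energyE // !(green_eval uD xD) (f1 x Ax).
  have kx : k x <= b by rewrite /k ge_min lexx orbT.
  have kx' : b^-1 ^+ 2 * k x <= b^-1.
    by rewrite expr2 -mulrA ger_pMr ?invr_gt0 // mulrC ler_pdivrMr // mul1r.
  lra.
rewrite lee_pV2 // !inE.
  by apply: le_trans le_inf; rewrite lee_fin invr_ge0 ltW.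
by rewrite lee_fin invr_ge0 ltW.
Qed.

End Resistance.

(** * Volumes of balls and comparison along one edge *)

Definition ballseq x (r : R) : seq G := fset_set (gball x r).

Lemma mem_ballseq x r y : (y \in ballseq x r) = ((gdist x y)%:R < r).
Proof.
rewrite /ballseq in_fset_set; last exact: gball_finite.
by apply/idP/idP => [/set_mem|xy]; [|apply/mem_set].
Qed.

Lemma ballseq_uniq x r : uniq (ballseq x r).
Proof. exact: fset_uniq. Qed.

Lemma set_ballseq x r : [set` ballseq x r] = gball x r.
Proof. by apply/seteqP; split=> y; rewrite /= mem_ballseq. Qed.

Definition rvol x (r : R) : R := \sum_(y <- ballseq x r) deg y.

Lemma volE x r : vol x r = (rvol x r)%:E.
Proof.
rewrite /vol /muset -set_ballseq esum_fset; first last.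
- by move=> y _; rewrite muE lee_fin ltW.
- exact: finite_seq.
rewrite -fsbig_seq ?ballseq_uniq // /rvol -sumEFin.
by apply: eq_bigr => y _; rewrite muE.
Qed.

Lemma ler_sum_sub (D D' : seq G) (F : G -> R) : uniq D -> uniq D' ->
  {subset D <= D'} -> (forall y, y \in D' -> 0 <= F y) ->
  \sum_(y <- D) F y <= \sum_(y <- D') F y.
Proof.
move=> uD uD' DD' F0; rewrite [leRHS](bigID (mem D)) /=.
have -> : \sum_(y <- D) F y = \sum_(y <- D' | y \in D) F y.
  rewrite -[RHS]big_filter; apply: perm_big; apply: uniq_perm => //.
  - exact: filter_uniq.
  - by move=> y; rewrite mem_filter; case: (boolP (y \in D)) => // /DD' ->.
by rewrite lerDl big_seq_cond; apply: sumr_ge0 => y /andP[/F0].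
Qed.

Lemma trans_le1 x y : trans x y <= 1.
Proof.
rewrite /trans -/(deg x) ler_pdivrMr ?deg_gt0 // mul1r.
have [xy|/weight_nadj ->] := boolP (adj x y); last by rewrite ltW.
rewrite degE (bigD1_seq y) ?nb_uniq ?mem_nb //= lerDl.
by apply: sumr_ge0 => z _; exact: weight_ge0.
Qed.

Lemma p0_le1 x : p0 <= 1.
Proof. by have [y xy] := exists_adj x; apply: le_trans (p0P xy) (trans_le1 x y). Qed.

(** Keep a single term of the average: u(x) >= Pu(x) >= P(x,y) u(y). *)
Lemma superharmonic_step u x y : (forall z, 0 <= u z) -> 0 <= lap u x ->
  adj x y -> p0 * u y <= u x.
Proof.
move=> u0 lu xy; have : markov_op u x <= u x.
  by move: lu; rewrite lap_markov pmulr_rge0 // subr_ge0.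
apply: le_trans; rewrite markov_opE (bigD1_seq y) ?nb_uniq ?mem_nb //=.
apply: (@le_trans _ _ (trans x y * u y)); first by rewrite ler_wpM2r ?p0P.
rewrite lerDl; apply: sumr_ge0 => z _.
by rewrite mulr_ge0 // /trans mulr_ge0 ?weight_ge0 // invr_ge0 ltW // deg_gt0.
Qed.

(** * Harnack chains *)

Section Chain.
Context (H : R) (H_gt1 : 1 < H).
Context (HP : forall (x : G) (r : R) (u : G -> R), 0 < r ->
  harmonic_on (gball x (2 * r)) u ->
  (forall y, gclosure (gball x (2 * r)) y -> 0 <= u y) ->
  forall y z, gball x r y -> gball x r z -> u y <= H * u z).

Lemma harnack x (r : R) (u : G -> R) y z : 0 < r -> (forall w, 0 <= u w) ->
  (forall w, (gdist x w)%:R < 2 * r -> lap u w = 0) ->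
  (gdist x y)%:R < r -> (gdist x z)%:R < r -> u y <= H * u z.
Proof.
move=> r0 u0 lu xy xz; apply: (HP r0 _ _ xy xz) => // w xw.
have := lu w xw; rewrite lap_markov => /eqP.
by rewrite mulf_eq0 gt_eqF //= subr_eq0 => /eqP.
Qed.

(* Covers both regimes of [chain]: for s <= 1 the path has at most K edges and each
   costs a factor p0^-1; for s > 1 one Harnack step jumps at least s / 4 edges. *)
Definition chain_const (K : R) : R :=
  (p0^-1 * H) ^+ (Num.truncn (4 * K)).+1.

Lemma path_dist (q : nat -> G) m : (forall i, (i < m)%N -> adj (q i) (q i.+1)) ->
  forall i j, (i <= j <= m)%N -> (gdist (q i) (q j) <= j - i)%N.
Proof.
move=> qa i j /andP[]; elim: j => [|j IH] ij jm.
  by move: ij; rewrite leqn0 => /eqP ->; rewrite gdistxx.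
move: ij; rewrite leq_eqVlt => /predU1P[->|ij]; first by rewrite gdistxx.
have := IH ij (ltnW jm); have := gdist_adj (qa _ jm).
have := gdist_triangle (q i) (q j) (q j.+1).
move: (gdist _ _) (gdist _ _) (gdist _ _) => a b c; clear -ij; lia.
Qed.

Lemma chain (K s : R) (u : G -> R) (q : nat -> G) m : 0 <= K -> 0 < s ->
  (forall w, 0 <= u w) -> m%:R <= K * s ->
  (forall i, (i < m)%N -> adj (q i) (q i.+1)) ->
  (forall i w, (i <= m)%N -> (gdist (q i) w)%:R < 2 * s -> lap u w = 0) ->
  u (q 0%N) <= chain_const K * u (q m).
Proof.
move=> K0 s0 u0 mK qa lu; rewrite /chain_const; set N := (Num.truncn (4 * K)).+1.
have KN : 4 * K < N%:R by exact: truncnS_gt.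
have p1 : 1 <= p0^-1 by rewrite invr_ge1 ?unitf_gt0 // ?p0_le1 //; exact: q 0%N.
have H1 := ltW H_gt1; have H0 : 0 <= H by exact: le_trans H1.
have pi0 : 0 <= p0^-1 by exact: le_trans p1.
have pH : p0^-1 <= p0^-1 * H by rewrite ler_peMr.
have Hp : H <= p0^-1 * H by rewrite ler_peMl.
have [s1|s1] := leP s 1.
  have mN : (m <= N)%N.
    rewrite -(ler_nat R); apply: le_trans mK _; apply: le_trans (ltW KN).
    by nra.
  apply: (@le_trans _ _ (p0^-1 ^+ m * u (q m))).
    elim: m mK qa lu {mN} => [|m IH] mK qa lu; first by rewrite mul1r.
    apply: (le_trans (IH _ _ _)) => [|i im|i w im|].
    - by apply: le_trans mK; rewrite ler_nat.
    - by apply: qa; exact: leqW.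
    - by apply: lu; exact: leqW.
    rewrite exprSr -mulrA ler_wpM2l ?exprn_ge0 //.
    rewrite ler_pdivlMl //; apply: superharmonic_step => //.
      by rewrite (lu m.+1) // gdistxx; lra.
    by rewrite adj_sym; apply: qa.
  apply: ler_wpM2r => //; apply: (@le_trans _ _ ((p0^-1 * H) ^+ m)).
    by apply: lerXn2r; rewrite ?nnegrE // mulr_ge0.
  by apply: ler_weXn2l => //; exact: le_trans pH.
(* The jump length: k < s keeps both ends of a jump in one Harnack ball, and s <= 4 k lets N jumps
   cover the m <= K s edges. *)
pose k := maxn 1 (Num.truncn (s / 2)).
have k1 : (1 <= k)%N by exact: leq_maxl.
have /andP[t1 t2] := truncn_itv (ltW (divr_gt0 s0 (ltr0Sn R 1))).
have ks : k%:R < s :> R.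
  by rewrite /k /maxn; case: ifP => _; [apply: le_lt_trans t1 _; lra|].
have sk : s <= 4 * k%:R.
  have h1 : 1 <= k%:R :> R by rewrite ler1n.
  have h2 : (Num.truncn (s / 2))%:R <= k%:R :> R by rewrite ler_nat leq_maxr.
  move: t2; rewrite -[(_ (s / 2)).+1%:R]natr1; lra.
have qd := path_dist qa.
have iter n : u (q 0%N) <= H ^+ n * u (q (minn (n * k) m)).
  elim: n => [|n IH]; first by rewrite mul0n min0n mul1r.
  apply: (le_trans IH); rewrite exprSr -mulrA ler_wpM2l ?exprn_ge0 //.
  have im : (minn (n * k) m <= m)%N by exact: geq_minr.
  apply: (harnack (x := q (minn (n * k) m)) s0) => // [w||].
  - exact: lu.
  - by rewrite gdistxx.
  - apply: le_lt_trans ks; rewrite ler_nat; apply: (leq_trans (qd _ _ _)); clear; lia.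
apply: (le_trans (iter N)); rewrite (minn_idPr _); last first.
  rewrite -(ler_nat R) natrM; apply: le_trans mK _.
  apply: (@le_trans _ _ ((4 * K) * k%:R)); first by nra.
  by rewrite ler_wpM2r // ltW.
by apply: ler_wpM2r => //; apply: lerXn2r; rewrite ?nnegrE // mulr_ge0.
Qed.

Lemma chain_const_ge1 K (x : G) : 1 <= chain_const K.
Proof.
have p1 : 1 <= p0^-1 by rewrite invr_ge1 ?unitf_gt0 // ?p0_le1 //; exact: x.
by rewrite /chain_const exprn_ege1 // mulr_ege1 // ltW.
Qed.

(** * The Green function on spheres around its pole *)

Section GreenHarnack.
Context (A : R) (A_gt1 : 1 < A) (x : G) (r : R) (r_ge1 : 1 <= r).
Let D := ballseq x (2 * r).
Let uD : uniq D := ballseq_uniq x (2 * r).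
(** Points at distance at least r / A = 32 s from x have room for the balls of radius up to 8 s on
    which harmonicity is required, without reaching x. Paths have at most M < r + 1 <= 2 r = 64 A s
    edges, whence the argument of [chain_const]. *)
Let s := r / (32 * A).
Context (M : nat) (rM : r <= M%:R) (Mr : M%:R < r + 1).
Let C1 := chain_const (64 * A).

Let r_gt0 : 0 < r. Proof. exact: lt_le_trans ltr01 r_ge1. Qed.
Let A_gt0 : 0 < A. Proof. exact: lt_trans ltr01 A_gt1. Qed.
Let s_gt0 : 0 < s. Proof. by rewrite divr_gt0 // mulr_gt0. Qed.
Let sE : 32 * s = r / A.
Proof. by rewrite /s; field; rewrite gt_eqF. Qed.
Let s_small : 32 * s < r.
Proof. by rewrite sE ltr_pdivrMr // ltr_pMr. Qed.
Let M_le : M%:R <= 64 * A * s.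
Proof.
have -> : 64 * A * s = 2 * r by rewrite /s; field; rewrite gt_eqF.
by have hr := r_ge1; have hM := Mr; lra.
Qed.
Let facts : [/\ 1 <= r, r <= M%:R, M%:R < r + 1, 1 < A & 0 < s /\ 32 * s < r].
Proof. by []. Qed.

(** For r >= 4 the triangle inequality suffices, as M < r + 1. For r < 4 the ball of radius r / 4 is
    the vertex q alone, and M < r + 1 <= 2 r. *)
Lemma near_sphere_inside q w :
  (gdist x q <= M)%N -> (gdist q w)%:R < r / 4 -> w \in D.
Proof.
have [hr hrM hMr hA [hs hsr]] := facts; have hH := H_gt1; have hsE := sE.
move=> qM qw; rewrite mem_ballseq.
have tri : (gdist x w)%:R <= (gdist x q)%:R + (gdist q w)%:R :> R.
  by rewrite -natrD ler_nat gdist_triangle.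
have qM' : (gdist x q)%:R <= M%:R :> R by rewrite ler_nat.
have [r4|r4] := ltP r 4; last by lra.
have : (gdist q w < 1)%N by rewrite -(ltr_nat R); lra.
rewrite ltnS leqn0 => /eqP e; move: tri; rewrite e; lra.
Qed.

Lemma sphere_inside q : (gdist x q <= M)%N -> q \in D.
Proof.
have [hr hrM hMr hA [hs hsr]] := facts; have hH := H_gt1; have hsE := sE.
by move=> qM; apply: (near_sphere_inside qM); rewrite gdistxx; lra. Qed.

(* A geodesic from x to z stays 2s away from y, since d(x,y) = d(x,z). *)
Lemma side_chain m y z : (m <= M)%N -> gdist x y = m -> gdist x z = m ->
  4 * s <= (gdist y z)%:R ->
  green D y x <= C1 * green D y z /\ green D y z <= C1 * green D y x.
Proof.
have [hr hrM hMr hA [hs hsr]] := facts; have hH := H_gt1; have hsE := sE.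
move=> mM xy xz yz; have [q [q0 qe qa qd]] := geodesic x z.
rewrite xz in qe qa qd.
have away i w : (i <= m)%N -> (gdist (q i) w)%:R < 2 * s -> lap (green D y) w = 0.
  move=> im qw; have xq : gdist x (q i) = i by rewrite -{1}q0 qd ?subn0.
  rewrite lap_green //; last by apply: (near_sphere_inside (q := q i)); rewrite ?xq; [nat_lia|lra].
  rewrite (_ : w == y = false) //; apply/eqP => wy; rewrite wy in qw.
  have t1 : (gdist x y <= gdist x (q i) + gdist (q i) y)%N by exact: gdist_triangle.
  have qz : gdist (q i) z = (m - i)%N by rewrite -qe qd // im leqnn.
  have t2 : (gdist y z <= gdist y (q i) + gdist (q i) z)%N by exact: gdist_triangle.
  have : (gdist y z <= 2 * gdist (q i) y)%N.
    by move: t2; rewrite (gdistC y (q i)); nat_lia.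
  rewrite -(ler_nat R) natrM; lra.
have mK : m%:R <= 64 * A * s by apply: le_trans M_le; rewrite ler_nat.
have K0 : 0 <= 64 * A by lra.
split.
  have := chain K0 s_gt0 (green_ge0 uD y) mK qa away.
  by rewrite q0 qe.
(* The converse inequality runs along the same geodesic backwards. *)
have := chain (q := fun i => q (m - i)%N) K0 s_gt0 (green_ge0 uD y) mK.
rewrite subn0 subnn q0 qe; apply=> [i im|i w im]; last by apply: away; nat_lia.
by rewrite adj_sym; have := qa (m - i.+1)%N; rewrite -subSn // subSS; apply; nat_lia.
Qed.

(** Close points share a Harnack ball away from x. Otherwise, writing g_p for the Green function
    with pole p, g_x(y) = g_y(x) <= C1 g_y(z) = C1 g_z(y) <= C1^2 g_z(x). *)
Lemma sphere_harnack m y z : (m <= M)%N -> r / A <= m%:R ->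
  gdist x y = m -> gdist x z = m ->
  green D x y <= H * C1 ^+ 2 * green D x z.
Proof.
have [hr hrM hMr hA [hs hsr]] := facts; have hH := H_gt1; have hsE := sE.
move=> mM mr xy xz.
have C1_ge1 : 1 <= C1 := chain_const_ge1 _ x.
have yD : y \in D by apply: sphere_inside; rewrite xy.
have zD : z \in D by apply: sphere_inside; rewrite xz.
have xD : x \in D by apply: sphere_inside; rewrite gdistxx.
have g0 := green_ge0 uD.
have C2 : 1 <= C1 ^+ 2 by rewrite exprn_ege1.
have [yz|yz] := ltP (gdist y z)%:R (4 * s).
  apply: (@le_trans _ _ (H * green D x z)); last first.
    by rewrite ler_wpM2r // ler_peMr //; lra.
  apply: (harnack (x := y) (r := 4 * s)) => //; first by lra.
  - move=> w yw; rewrite lap_green //; last first.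
      by apply: (near_sphere_inside (q := y)); rewrite ?xy //; lra.
    rewrite (_ : w == x = false) //; apply/eqP => wx.
    by move: yw; rewrite wx gdistC xy; lra.
  - by rewrite gdistxx; lra.
have [s1 _] := side_chain mM xy xz yz.
have [_ s2] : green D z x <= C1 * green D z y /\ green D z y <= C1 * green D z x.
  by apply: side_chain mM xz xy _; rewrite gdistC.
rewrite (green_sym uD xD yD) (green_sym uD xD zD).
rewrite (green_sym uD yD zD) in s1.
apply: (@le_trans _ _ (C1 * (C1 * green D z x))).
  by apply: le_trans s1 _; rewrite ler_wpM2l //; lra.
rewrite mulrA -expr2 ler_wpM2r // ler_peMl //; lra.
Qed.

Lemma radial_harnack m (q : nat -> G) : (m <= M)%N -> r / A <= m%:R ->
  (forall i, (i <= M)%N -> gdist x (q i) = i) ->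
  (forall i, (i < M)%N -> adj (q i) (q i.+1)) ->
  green D x (q m) <= C1 * green D x (q M).
Proof.
have [hr hrM hMr hA [hs hsr]] := facts; have hH := H_gt1; have hsE := sE.
move=> mM mr xq qa; have K0 : 0 <= 64 * A by lra.
have mK : (M - m)%:R <= 64 * A * s by apply: le_trans M_le; rewrite ler_nat leq_subr.
have := chain (q := fun i => q (m + i)%N) K0 s_gt0 (green_ge0 uD x) mK.
rewrite addn0 subnKC //; apply=> [i im|i w im qw].
  by rewrite addnS; apply: qa; nat_lia.
have xqi := xq (m + i)%N.
rewrite lap_green //; last first.
  by apply: (near_sphere_inside (q := q (m + i)%N)); [rewrite xqi|]; [nat_lia|nat_lia|lra].
rewrite (_ : w == x = false) //; apply/eqP => wx.
move: qw; rewrite wx gdistC xqi; last by nat_lia.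
by rewrite natrD; have := ler0n R i; lra.
Qed.

(** The geodesic from x to z crosses the inner sphere; move along that sphere to the crossing point,
    then outwards, where the path stays away from x. *)
Lemma spheres_harnack m y z : (m <= M)%N -> r / A <= m%:R ->
  gdist x y = m -> gdist x z = M ->
  green D x y <= H * C1 ^+ 3 * green D x z.
Proof.
have [hr hrM hMr hA [hs hsr]] := facts; have hH := H_gt1; have hsE := sE.
move=> mM mr xy xz; have [q [q0 qe qa qd]] := geodesic x z.
rewrite xz in qe qa qd.
have xq i : (i <= M)%N -> gdist x (q i) = i by move=> iM; rewrite -{1}q0 qd ?subn0.
apply: (le_trans (sphere_harnack mM mr xy (xq _ mM))).
have C1_ge0 : 0 <= C1 by apply: le_trans (chain_const_ge1 _ x).
rewrite [leRHS](_ : _ = H * C1 ^+ 2 * (C1 * green D x z)); last by ring.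
have C2_ge0 : 0 <= H * C1 ^+ 2 by apply: mulr_ge0; [lra|exact: exprn_ge0].
rewrite ler_wpM2l //.
by rewrite -qe; exact: radial_harnack.
Qed.

(** A zero at the pole would make [lap] nonpositive there, although it equals 1; positivity then
    spreads along a geodesic edge by edge. *)
Lemma green_gt0 z : (gdist x z <= M)%N -> 0 < green D x z.
Proof.
have [hr hrM hMr hA [hs hsr]] := facts; have hH := H_gt1; have hsE := sE.
move=> zM; have [q [q0 qe qa qd]] := geodesic x z.
have xD : x \in D by apply: sphere_inside; rewrite gdistxx.
have lap_ge0 w : w \in D -> 0 <= lap (green D x) w by move=> wD; rewrite lap_green.
have : forall i, (i <= gdist x z)%N -> 0 < green D x (q i).
  elim=> [|i IH] iz.
    rewrite q0 lt_def green_ge0 // andbT; apply/eqP => g0.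
    have := lap_green uD x xD; rewrite eqxx /lap => /eqP.
    apply/negP; rewrite lt_eqF // (le_lt_trans _ ltr01) //.
    apply: sumr_le0 => w _; rewrite g0 sub0r mulrN oppr_le0.
    by rewrite mulr_ge0 ?weight_ge0 // green_ge0.
  apply: (@lt_le_trans _ _ (p0 * green D x (q i))).
    by rewrite mulr_gt0 // IH // ltnW.
  apply: superharmonic_step; first exact: green_ge0.
    apply: lap_ge0; apply: sphere_inside; rewrite -{1}q0 qd //; nat_lia.
  by rewrite adj_sym; apply: qa.
by move=> /(_ _ (leqnn _)); rewrite qe.
Qed.

Lemma green_bounds : exists2 a : R, 0 < a &
  (forall y, (gdist x y)%:R < r -> a <= green D x y) /\
  (forall y, r / A <= (gdist x y)%:R -> green D x y <= H * C1 ^+ 3 * a).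
Proof.
have [hr hrM hMr hA [hs hsr]] := facts; have hH := H_gt1; have hsE := sE.
have [z0 xz0] := exists_dist x M.
pose Sph := [seq z <- D | gdist x z == M].
have memS z : (z \in Sph) = (gdist x z == M).
  rewrite mem_filter; case: eqP => //= e; apply: sphere_inside; by rewrite e.
have [z] := @seq_max Sph (fun w => - green D x w) z0 ltac:(by rewrite memS xz0).
rewrite memS => /eqP xz zmin.
(* The height a is the minimum of g over the sphere of radius M, the ceiling of r. *)
exists (green D x z); first by apply: green_gt0; rewrite xz.
have C0 : 0 <= H * C1 ^+ 3.
  have := chain_const_ge1 (64 * A) x; rewrite -/C1 => ?.
  by apply: mulr_ge0; [lra|apply: exprn_ge0; lra].
have g0 := green_ge0 uD.
split=> y.
  rewrite -mem_ballseq; apply: min_principle => [w|p q].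
    rewrite mem_ballseq => wr; rewrite lap_green // /D mem_ballseq; lra.
  rewrite !mem_ballseq -leNgt => pr pq qr.
  (* By integrality, every edge leaving the open ball of radius r ends exactly on the sphere of
     radius M. *)
  have e : gdist x q = M.
    have h1 : (gdist x q <= (gdist x p).+1)%N.
      have := gdist_triangle x p q; have := gdist_adj pq; nat_lia.
    have h2 : (gdist x p < M)%N by rewrite -(ltr_nat R); lra.
    have h3 : (M < (gdist x q).+1)%N by rewrite -(ltr_nat R) -natr1; lra.
    nat_lia.
  by rewrite -lerN2; apply: zmin; rewrite memS e.
have rA0 : 0 <= r / A by rewrite divr_ge0 // ltW.
have [T /andP[tT Tt]] := nat_ceil rA0.
have rAr : r / A < r by rewrite -sE.
have TM : (T <= M)%N by rewrite -ltnS -(ltr_nat R) -natr1; lra.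
have onT w : gdist x w = T -> green D x w <= H * C1 ^+ 3 * green D x z.
  by move=> e; apply: (spheres_harnack TM tT e xz).
move=> yr; have Ty : (T <= gdist x y)%N by rewrite -ltnS -(ltr_nat R) -natr1; lra.
have [yD|/(green_off uD) ->] := boolP (y \in D); last by rewrite mulr_ge0.
move: Ty; rewrite leq_eqVlt => /predU1P[/esym/onT//|Ty].
apply: (max_principle (D := [seq w <- D | (T < gdist x w)%N])).
- move=> w; rewrite mem_filter => /andP[Tw wD]; rewrite lap_green //.
  by case: eqP => // wx; move: Tw; rewrite wx gdistxx.
- move=> p q; rewrite !mem_filter => /andP[Tp pD] pq.
  case: (boolP (q \in D)) => [qD|/(green_off uD) -> _]; last by rewrite mulr_ge0.
  rewrite andbT -leqNgt => qT; apply: onT.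
  have := gdist_triangle x q p; have := gdist_adj pq.
  rewrite (gdistC p q); nat_lia.
- by rewrite mem_filter Ty.
Qed.

End GreenHarnack.
End Chain.

(** * Comparison of exit time, resistance and volume *)

Lemma rvol_mono x y (r t : R) :
  (forall w, (gdist x w)%:R < r -> (gdist y w)%:R < t) -> rvol x r <= rvol y t.
Proof.
move=> sub; apply: ler_sum_sub; rewrite ?ballseq_uniq //.
  by move=> w; rewrite !mem_ballseq; exact: sub.
by move=> w _; exact: ltW.
Qed.

Lemma rvol_ge0 x (r : R) : 0 <= rvol x r.
Proof. by apply: sumr_ge0 => y _; exact: ltW. Qed.

Section Doubling.
Context (Dv : R) (Dv_gt0 : 0 < Dv).
Context (VD : forall x (r : R), 0 < r -> (vol x (2 * r) <= Dv%:E * vol x r)%E).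

Lemma rvol_doubling x (r : R) : 0 < r -> rvol x (2 * r) <= Dv * rvol x r.
Proof. by move=> /(VD x); rewrite !volE -EFinM lee_fin. Qed.

(** Below r = 8 the small ball is a single vertex and the ceiling of r works; from there on,
    rounding up 9 r / 8 still leaves a margin of r / 8 on both sides. *)
Lemma annulus_sphere x (r : R) : 1 <= r -> exists m : nat, forall q w,
  gdist x q = m -> (gdist q w)%:R < r / 8 -> r <= (gdist x w)%:R < 2 * r.
Proof.
move=> r1; have [r8|r8] := ltP r 8.
  have [m /andP[rm mr]] := @nat_ceil R r ltac:(lra).
  exists m => q w xq qw; have : (gdist q w < 1)%N by rewrite -(ltr_nat R); lra.
  rewrite ltnS leqn0 gdist_eq0 => /eqP <-; rewrite xq; lra.
have [m /andP[rm mr]] := @nat_ceil R (9 / 8 * r) ltac:(lra).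
exists m => q w xq qw.
have t1 : (gdist x w)%:R <= (gdist x q)%:R + (gdist q w)%:R :> R.
  by rewrite -natrD ler_nat gdist_triangle.
have t2 : (gdist x q)%:R <= (gdist x w)%:R + (gdist q w)%:R :> R.
  by rewrite -natrD ler_nat (gdistC q w) gdist_triangle.
rewrite xq in t1 t2; lra.
Qed.

(** The annulus contains a ball B(y, r / 8), and B(x, 2 r) lies in B(y, 4 r); five doublings lead
    from r / 8 to 4 r. *)
Lemma annulus_volume x (r : R) : 1 <= r ->
  rvol x (2 * r) <= Dv ^+ 5 * (rvol x (2 * r) - rvol x r).
Proof.
move=> r1; have [m mP] := annulus_sphere x r1; have [y xy] := exists_dist x m.
have ball_sub w : (gdist y w)%:R < r / 8 -> r <= (gdist x w)%:R < 2 * r by exact: mP.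
have dbl t : 0 < t -> rvol y (2 * t) <= Dv * rvol y t by exact: rvol_doubling.
have cov : rvol x (2 * r) <= rvol y (2 * (2 * (2 * (2 * (2 * (r / 8)))))).
  apply: rvol_mono => w xw; have /andP[_ h1] := ball_sub y ltac:(rewrite gdistxx; lra).
  have : (gdist y w)%:R <= (gdist x y)%:R + (gdist x w)%:R :> R.
    by rewrite -natrD ler_nat (gdistC x y) gdist_triangle.
  lra.
have dbl5 : rvol x (2 * r) <= Dv ^+ 5 * rvol y (r / 8).
  have r0 : 0 < r / 8 by lra.
  apply: (le_trans cov); rewrite !exprS expr0 mulr1 -!mulrA.
  do 5 (apply: (le_trans (dbl _ _)); [by lra|rewrite ler_pM2l //]).
apply: (le_trans dbl5); rewrite ler_wpM2l ?exprn_ge0 ?(ltW Dv_gt0) // lerBrDl.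
rewrite -big_cat /=; apply: ler_sum_sub; rewrite ?ballseq_uniq //.
- rewrite cat_uniq !ballseq_uniq andbT /=; apply/hasPn => w.
  by rewrite mem_ballseq => /ball_sub /andP[rw _]; rewrite /= mem_ballseq -leNgt.
- move=> w; rewrite mem_cat !mem_ballseq => /orP[wr|/ball_sub/andP[]//]; lra.
- by move=> w _; exact: ltW.
Qed.

Context (H : R) (H_gt1 : 1 < H).
Context (HP : forall (x : G) (r : R) (u : G -> R), 0 < r ->
  harmonic_on (gball x (2 * r)) u ->
  (forall y, gclosure (gball x (2 * r)) y -> 0 <= u y) ->
  forall y z, gball x r y -> gball x r z -> u y <= H * u z).
Context (A : R) (A_gt1 : 1 < A).

Let K := H * chain_const H (64 * A) ^+ 3.

Let K_ge1 (x : G) : 1 <= K.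
Proof.
rewrite /K mulr_ege1 ?(ltW H_gt1) // exprn_ege1 //.
by apply: chain_const_ge1 => //; exact: x.
Qed.

(** Nothing is lost by [fine] when 1 <= r: [green_resistance] shows that the resistance is
    finite. *)
Definition res x (r : R) : R := fine (annulus_res x r (2 * r)).

Lemma green_resistance x (r : R) : 1 <= r -> exists a : R,
  [/\ 0 < a, forall y, (gdist x y)%:R < r -> a <= green (ballseq x (2 * r)) x y,
      forall y, r / A <= (gdist x y)%:R -> green (ballseq x (2 * r)) x y <= K * a,
      annulus_res x r (2 * r) = (res x r)%:E & a <= res x r <= K * a / p0].
Proof.
move=> r1; have r0 : 0 < r by lra.
have [M /andP[rM Mr]] := @nat_ceil R r (ltW r0).
have [a a0 [ga gK]] := green_bounds H_gt1 HP A_gt1 x r1 rM Mr.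
rewrite -/K in gK.
set D := ballseq x (2 * r) in ga gK *; have uD : uniq D := ballseq_uniq _ _.
have xD : x \in D by rewrite mem_ballseq gdistxx; lra.
have lo : (a%:E <= annulus_res x r (2 * r))%E.
  by rewrite /annulus_res -(set_ballseq x (2 * r)); apply: (resistance_ge uD xD a0).
have K1 := K_ge1 x; have p1 := p0_le1 x; have pp : 0 < p0 by [].
have rAr : r / A <= r.
  by rewrite ler_pdivrMr ?ler_peMr ?ltW // (lt_trans ltr01).
have KaP : 0 < K * a by rewrite mulr_gt0 //; lra.
have hi : (annulus_res x r (2 * r) <= (K * a / p0)%:E)%E.
  rewrite /annulus_res -(set_ballseq x (2 * r)); apply: (resistance_le uD xD).
  - by rewrite divr_gt0.
  - by rewrite /gball /= gdistxx.
  move=> p gp; have pr : (gdist x p)%:R < r.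
    rewrite ltNge; apply/negP => rp; have := gK p (le_trans rAr rp).
    apply/negP; rewrite -ltNge; apply: le_lt_trans gp.
    by rewrite ler_pdivlMr // ler_piMr // ltW.
  split=> // q pq; rewrite /gball /= ltNge; apply/negP => rq.
  have qD : q \in D.
    rewrite mem_ballseq.
    have : (gdist x q)%:R <= (gdist x p)%:R + (gdist p q)%:R :> R.
      by rewrite -natrD ler_nat gdist_triangle.
    have : (gdist p q)%:R <= 1%:R :> R by rewrite ler_nat gdist_adj.
    lra.
  have : p0 * green D x p <= green D x q.
    apply: superharmonic_step; [exact: green_ge0|by rewrite lap_green|by rewrite adj_sym].
  have := gK q (le_trans rAr rq).
  by rewrite ltr_pdivrMr // in gp; lra.
have fin : annulus_res x r (2 * r) = (res x r)%:E.
  by rewrite /res; move: lo hi; case: (annulus_res x r (2 * r)).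
exists a; split=> //; rewrite fin !lee_fin in lo hi; exact/andP.
Qed.

(** * Exit time against resistance times volume, across scales *)

Definition exit_sum x (r : R) : R :=
  \sum_(y <- ballseq x (2 * r)) green (ballseq x (2 * r)) x y * deg y.

Definition rv x (r : R) : R := res x r * (rvol x (2 * r) - rvol x r).

Lemma res_volE x (r : R) : 1 <= r -> res_vol x r = (rv x r)%:E.
Proof.
move=> r1; have [a [_ _ _ e _]] := green_resistance x r1.
by rewrite /res_vol e /annulus_vol !volE -EFinB -EFinM.
Qed.

Lemma annulus_ge0 x (r : R) : 1 <= r -> 0 <= rvol x (2 * r) - rvol x r.
Proof. by move=> r1; rewrite subr_ge0; apply: rvol_mono => w; lra. Qed.

Lemma rv_ge0 x (r : R) : 1 <= r -> 0 <= rv x r.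
Proof.
move=> r1; have [a [a0 _ _ _ /andP[ar _]]] := green_resistance x r1.
by rewrite mulr_ge0 ?annulus_ge0 // (le_trans _ ar) // ltW.
Qed.

Lemma exit_sum_lower x (r : R) : 1 <= r -> rv x r <= K / p0 * Dv * exit_sum x r.
Proof.
move=> r1; have [a [a0 ga _ _ /andP[_ rK]]] := green_resistance x r1.
have K1 := K_ge1 x; have Kp : 0 <= K / p0 by rewrite divr_ge0 ?ltW //; lra.
have aV : a * rvol x r <= exit_sum x r.
  rewrite /rvol mulr_sumr; apply: le_trans (ler_sum_sub (D := ballseq x r) _ _ _ _).
  - rewrite !big_seq; apply: ler_sum => y.
    by rewrite mem_ballseq => yr; rewrite ler_wpM2r ?ga // ltW.
  - exact: ballseq_uniq.
  - exact: ballseq_uniq.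
  - by move=> w; rewrite !mem_ballseq; lra.
  - by move=> w _; rewrite mulr_ge0 ?green_ge0 ?ballseq_uniq // ltW.
have vV : rvol x (2 * r) - rvol x r <= Dv * rvol x r.
  apply: le_trans (rvol_doubling x _); last by lra.
  by rewrite gerBl rvol_ge0.
apply: (@le_trans _ _ (K * a / p0 * (Dv * rvol x r))).
  apply: ler_pM => //; last exact: annulus_ge0.
  by have [b [b0 _ _ _ /andP[br _]]] := green_resistance x r1; lra.
rewrite [leLHS](_ : _ = K / p0 * Dv * (a * rvol x r)); last by ring.
by rewrite ler_wpM2l // mulr_ge0 // ltW.
Qed.

Let U := K / p0 * Dv ^+ 5.

(** Converts a bound K a / p0 on a Green function over the whole ball into a multiple of rho v: a is
    below the resistance, and the annulus carries a fixed share of the volume. *)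
Let vol_rv x (r a : R) : 1 <= r -> 0 < a -> a <= res x r ->
  K / p0 * a * rvol x (2 * r) <= U * rv x r.
Proof.
move=> r1 a0 ar; have K1 := K_ge1 x; have Kp : 0 <= K / p0 by rewrite divr_ge0 ?ltW //; lra.
rewrite [leRHS](_ : _ = K / p0 * res x r * (Dv ^+ 5 * (rvol x (2 * r) - rvol x r))).
  apply: ler_pM.
  - by apply: mulr_ge0 => //; exact: ltW.
  - exact: rvol_ge0.
  - by rewrite ler_wpM2l.
  - exact: annulus_volume.
by rewrite /U /rv; ring.
Qed.

Lemma exit_sum_base x (r : R) : 1 <= r -> r < A -> exit_sum x r <= U * rv x r.
Proof.
move=> r1 rA; have [a [a0 ga gK _ /andP[ar _]]] := green_resistance x r1.
apply: le_trans (vol_rv r1 a0 ar); rewrite /rvol mulr_sumr; apply: ler_sum => y _.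
set D := ballseq x (2 * r) in ga gK *; have uD : uniq D := ballseq_uniq _ _.
have K1 := K_ge1 x; have p1 := p0_le1 x; have pp : 0 < p0 by [].
have Ka : 0 <= K * a by rewrite mulr_ge0 ?ltW //; lra.
have far z : z != x -> green D x z <= K * a.
  move=> zx; apply: gK; apply: (@le_trans _ _ 1).
    by rewrite ler_pdivrMr ?mul1r ?ltW // (lt_trans ltr01).
  by rewrite ler1n lt0n gdist_eq0 eq_sym.
rewrite ler_wpM2r ?(ltW (deg_gt0 y)) // -mulrA mulrA mulrAC ler_pdivlMr //.
have [->|yx] := eqVneq y x; last first.
  apply: le_trans (far _ yx); rewrite ler_piMr // green_ge0 //.
(* At the pole, g is at most its value at a neighbour divided by p0. *)
have [z xz] := exists_dist x 1%N.
have adjxz : adj x z.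
  have [p [xp pz]] := gdist_walk x z; rewrite xz.
  by case: p xp pz => [|b [|c p]] //= /andP[xb _] <-.
have zx : z != x by rewrite eq_sym -gdist_eq0 xz.
rewrite mulrC; apply: le_trans (far _ zx).
apply: superharmonic_step; [exact: green_ge0| |by rewrite adj_sym].
by rewrite lap_green // mem_ballseq xz; lra.
Qed.

(** The point masses of the two Green functions cancel, so their difference is harmonic in the
    smaller ball; outside it only the larger Green function survives, and it is at most K a. *)
Lemma exit_sum_step x (r : R) : 1 <= r -> A <= r ->
  exit_sum x r <= exit_sum x (r / A) + U * rv x r.
Proof.
move=> r1 Ar; have [a [a0 ga gK _ /andP[ar _]]] := green_resistance x r1.
have A0 : 0 < A by exact: lt_trans A_gt1.
have rA0 : 0 < r / A by rewrite divr_gt0 //; lra.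
have rAr : r / A <= r by rewrite ler_pdivrMr // ler_peMr ?ltW //; lra.
apply: (@le_trans _ _ (exit_sum x (r / A) + K / p0 * a * rvol x (2 * r))); last first.
  by rewrite lerD2l; exact: vol_rv.
rewrite /exit_sum; set D := ballseq x (2 * r) in ga gK *.
set D' := ballseq x (2 * (r / A)).
have uD : uniq D := ballseq_uniq _ _; have uD' : uniq D' := ballseq_uniq _ _.
have DD' : {subset D' <= D} by move=> y; rewrite !mem_ballseq; lra.
have K1 := K_ge1 x; have p1 := p0_le1 x; have pp : 0 < p0 by [].
have Ka : 0 <= K * a by rewrite mulr_ge0 ?ltW //; lra.
have out q : q \notin D' -> green D x q <= K * a.
  by rewrite mem_ballseq -leNgt => qr; apply: gK; lra.
have diff y : green D x y - green D' x y <= K * a.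
  have [yD|yD] := boolP (y \in D'); last first.
    by rewrite (green_off uD' _ yD) subr0 out.
  rewrite -[X in X <= _](_ : (-1) * green D' x y + green D x y = _); last by ring.
  apply: (max_principle (D := D')
    (f := fun y => (-1) * green D' x y + green D x y)) yD.
  - move=> z zD'; rewrite lap_lin !lap_green // ?DD' //; lra.
  - by move=> p q _ _ qD'; rewrite (green_off uD' _ qD') mulr0 add0r out.
rewrite -(@sum_supp D D' (fun y => green D' x y * deg y)) //; last first.
  by move=> y yD'; rewrite green_off // mul0r.
rewrite /rvol mulr_sumr -big_split /=; apply: ler_sum => y _.
rewrite -mulrDl ler_wpM2r ?(ltW (deg_gt0 y)) //.
have : K * a <= K / p0 * a.
  by rewrite [leRHS]mulrAC ler_pdivlMr // ler_piMr.
have := diff y; lra.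
Qed.

Context (AD : forall x (r : R), 0 < r -> (2%:E * res_vol x r <= res_vol x (A * r))%E).

Lemma exit_sum_upper x (r : R) : 1 <= r -> exit_sum x r <= 2 * U * rv x r.
Proof.
move=> r1; have [n] := expr_unbounded r A_gt1.
have K1 := K_ge1 x.
have U0 : 0 <= U.
  by rewrite mulr_ge0 ?exprn_ge0 ?divr_ge0 ?ltW //; lra.
(* The radius being real, the induction is on n with r < A ^ n; n = 0 contradicts 1 <= r. *)
elim: n r r1 => [|n IH] r r1 rA; first by move: rA; rewrite expr0; lra.
have rv0 := rv_ge0 x r1; have Urv : 0 <= U * rv x r by rewrite mulr_ge0.
have [Ar|Ar] := ltP r A.
  by apply: (le_trans (exit_sum_base x r1 Ar)); lra.
have A0 : 0 < A by exact: lt_trans A_gt1.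
have rA1 : 1 <= r / A by rewrite ler_pdivlMr // mul1r.
have {}IH := IH _ rA1 ltac:(by rewrite ltr_pdivrMr // -exprSr).
have := AD x (lt_le_trans ltr01 rA1).
rewrite [A * _]mulrC divfK ?gt_eqF // !res_volE // -EFinM lee_fin => dbl.
apply: (le_trans (exit_sum_step x r1 Ar)).
have : U * (2 * rv x (r / A)) <= U * rv x r by rewrite ler_wpM2l.
lra.
Qed.

End Doubling.

End ControlledWeights.

Theorem theorem6p2 (R : realType) (G : wgraph R)
  (d : measure_display) (Omega : measurableType d)
  (Pr : G -> probability Omega R) (X : nat -> Omega -> G)
  (hX : random_walk Pr X)
  (hp0 : cond_p0 G) (hVD : volume_doubling G)
  (hH : elliptic_harnack G) (hA : anti_doubling G) :
  exists2 C : R, 1 < C &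
    forall (x : G) (r : R), 1 <= r ->
      ((C^-1)%:E * (annulus_res x r (2 * r) * annulus_vol x r (2 * r))
         <= mean_exit_time Pr X x (2 * r))%E /\
      (mean_exit_time Pr X x (2 * r)
         <= C%:E * (annulus_res x r (2 * r) * annulus_vol x r (2 * r)))%E.
Proof.
have [p0 p0_gt0 p0P] := hp0; have [Dv Dv_gt0 VD] := hVD.
have [H H_gt1 HP] := hH; have [A A_gt1 AD] := hA.
pose K := H * chain_const p0 H (64 * A) ^+ 3.
pose L := K / p0 * Dv; pose U := K / p0 * Dv ^+ 5.
have K0 : 0 < K.
  rewrite mulr_gt0 ?exprn_gt0 ?mulr_gt0 ?invr_gt0 //; exact: lt_trans H_gt1.
have L0 : 0 < L by rewrite mulr_gt0 ?divr_gt0.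
have U0 : 0 < U by rewrite mulr_gt0 ?divr_gt0 ?exprn_gt0.
have C0 : 0 < 1 + L + 2 * U by lra.
(* L serves the lower bound and 2 U the upper one; the summand 1 makes C > 1. *)
exists (1 + L + 2 * U) => [|x r r1]; first by lra.
rewrite -[(annulus_res x r (2 * r) * _)%E]/(res_vol x r).
rewrite (res_volE p0_gt0 p0P H_gt1 HP A_gt1 x r1).
have r20 : 0 < 2 * r by lra.
have -> : mean_exit_time Pr X x (2 * r) = (exit_sum x r)%:E.
  rewrite /mean_exit_time -(set_ballseq p0_gt0 p0P) (exit_time_green p0_gt0 p0P _ hX) //.
    exact: ballseq_uniq.
  by rewrite (mem_ballseq p0_gt0 p0P) gdistxx.
have rv0 := rv_ge0 p0_gt0 p0P H_gt1 HP A_gt1 x r1.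
have lo := exit_sum_lower p0_gt0 p0P Dv_gt0 VD H_gt1 HP A_gt1 x r1.
have hi := exit_sum_upper p0_gt0 p0P Dv_gt0 VD H_gt1 HP A_gt1 AD x r1.
rewrite -!EFinM !lee_fin; split.
  rewrite ler_pdivrMl //; apply: (le_trans lo); rewrite -/K -/L.
  have E0 : 0 <= exit_sum x r.
    by rewrite -(pmulr_rge0 _ L0); apply: le_trans lo.
  by rewrite ler_wpM2r //; lra.
apply: (le_trans hi); rewrite -/K -/U ler_wpM2r //; lra.
Qed.
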